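(* Let $k$ be a field of prime characteristic $p$ and let $G$ be a generalized pendant cliques graph on the vertex set $[n]=\{1,\dots,n\}$, with binomial edge ideal $J_G\subseteq S=k[x_1,\dots,x_n,y_1,\dots,y_n]$. Then $J_G$ is symbolic $F$-split.
   Context: All graphs are finite and simple. Clique joins: for a graph $H$, a vertex $v\in V(H)$ and $t\ge 2$, the clique join of $K_t$ on $H$ via $v$ is obtained from $H$ by adding $t-1$ new vertices $u_1,\dots,u_{t-1}$, all edges $\{u_i,v\}$, and all edges $\{u_i,u_j\}$, $i<j$. For an edge $e=\{w_1,w_2\}\in E(H)$ and $t\ge 3$, the clique join of $K_t$ on $H$ via $e$ is obtained from $H$ by adding $t-2$ new vertices $u_1,\dots,u_{t-2}$, all edges $\{u_i,w_j\}$ for $1\le i\le t-2$, $j=1,2$, and all edges $\{u_i,u_j\}$, $i<j$. Generalized pendant cliques graph: a graph obtained from a path $P$ by clique joins of complete graphs, with an arbitrary finite number of clique joins via each vertex of $P$ and at most one clique join via each edge of $P$. Binomial edge ideal: for a graph $G$ on $[n]$, $J_G$ is the ideal of $S$ generated by the binomials $f_{i,j}=x_iy_j-y_ix_j$ with $\{i,j\}\in E(G)$. Symbolic power: if $I$ is an ideal of a Noetherian ring with minimal primes $\mathfrak p_1,\dots,\mathfrak p_r$, then $I^{(m)}=\mathfrak q_1\cap\dots\cap\mathfrak q_r$, where $\mathfrak q_i$ is the $\mathfrak p_i$-primary component of $I^m$; $I^{(0)}$ is the whole ring. Symbolic $F$-split: let $R$ be a reduced Noetherian ring of prime characteristic $p$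 and let $R^{1/p}$ be the ring obtained by adjoining all $p$-th roots of elements of $R$. A sequence $\{I_n\}_{n\ge0}$ of ideals of $R$ is an $F$-split filtration if: (1) $I_0=R$; (2) $I_{n+1}\subseteq I_n$ for all $n\ge 0$; (3) $I_nI_m\subseteq I_{n+m}$ for all $n,m\ge0$; (4) there is a splitting $\phi:R^{1/p}\to R$ of the inclusion $R\subseteq R^{1/p}$ ($\phi$ is $R$-linear with $\phi|_R=\mathrm{id}_R$) such that $\phi((I_{np+1})^{1/p})\subseteq I_{n+1}$ for every $n\ge0$. An ideal $I\subseteq R$ is symbolic $F$-split if $\{I^{(n)}\}_{n\ge0}$ is an $F$-split filtration. *)

(* Defs.v *)
From HB Require Import structures.
From mathcomp Require Import all_boot all_order all_algebra.
From mathcomp Require Import mpoly.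

Set Implicit Arguments.
Unset Strict Implicit.
Unset Printing Implicit Defensive.

Import GRing.Theory.
Local Open Scope ring_scope.

(* Ideals are Prop-valued subsets of the ring: mathcomp's idealr_closed and
   prime_idealr_closed are about boolean predicates, hence about ideals with
   decidable membership. *)
Section Ideals.
Variable R : comNzRingType.
Implicit Types (A I J P Q : R -> Prop) (m : nat).

Definition sub_set I J : Prop := forall a, I a -> J a.
Definition eq_set I J : Prop := forall a, I a <-> J a.

Definition is_ideal I : Prop :=
  [/\ I 0, (forall a b, I a -> I b -> I (a + b))
    & (forall r a, I a -> I (r * a))].

Definition gen_ideal A : R -> Prop :=
  fun a => forall I, is_ideal I -> sub_set A I -> I a.

Definition ideal_mul I J : R -> Prop :=
  gen_ideal (fun c => exists a b, [/\ I a, J b & c = a * b]).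

Fixpoint ideal_pow I m : R -> Prop :=
  if m is m'.+1 then ideal_mul I (ideal_pow I m') else fun=> True.

Definition is_prime_ideal P : Prop :=
  [/\ is_ideal P, ~ P 1 & forall a b, P (a * b) -> P a \/ P b].

Definition is_minimal_prime I P : Prop :=
  [/\ is_prime_ideal P, sub_set I P
    & forall Q, is_prime_ideal Q -> sub_set I Q -> sub_set Q P -> sub_set P Q].

Definition radical I : R -> Prop := fun a => exists m, I (a ^+ m).

Definition is_primary_ideal Q : Prop :=
  [/\ is_ideal Q, ~ Q 1 & forall a b, Q (a * b) -> Q a \/ radical Q b].

Definition is_min_primary_decomposition J s (Q : 'I_s -> R -> Prop) : Prop :=
  [/\ forall i, is_primary_ideal (Q i),
      eq_set J (fun a => forall i, Q i a),
      forall i j, i != j -> ~ eq_set (radical (Q i)) (radical (Q j))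
    & forall i, ~ sub_set (fun a => forall j, j != i -> Q j a) (Q i)].

Definition is_primary_component P J q : Prop :=
  exists s (Q : 'I_s -> R -> Prop), is_min_primary_decomposition J Q /\
    exists i, eq_set (radical (Q i)) P /\ eq_set (Q i) q.

(* For R Noetherian and P a minimal prime of I, the P-primary component of a
   positive power of I exists and is unique. *)
Definition symbolic_power I m : R -> Prop :=
  if m is 0%N then fun=> True
  else fun a => forall P q, is_minimal_prime I P ->
         is_primary_component P (ideal_pow I m) q -> q a.

(* E is R^{1/p}: a reduced extension of R, all of whose elements are p-th roots
   of elements of R, and in which every element of R has a p-th root.  For R
   reduced of characteristic p, these properties determine E up to a unique
   isomorphism of R-algebras; existence is is_pth_root_ring_frob below. *)
Definition is_pth_root_ring (p : nat) (E : comAlgType R) : Prop :=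
  [/\ injective (in_alg E),
      forall (z : E) m, z ^+ m = 0 -> z = 0,
      forall r : R, exists z : E, z ^+ p = r%:A
    & forall z : E, exists r : R, z ^+ p = r%:A].

(* I^{1/p} *)
Definition pth_roots (p : nat) (E : comAlgType R) I : E -> Prop :=
  fun z => exists2 a, I a & z ^+ p = a%:A.

Definition F_split_filtration (p : nat) (I : nat -> R -> Prop) : Prop :=
  [/\ forall n, is_ideal (I n),
      forall a, I 0%N a,
      forall n, sub_set (I n.+1) (I n),
      forall n m, sub_set (ideal_mul (I n) (I m)) (I (n + m)%N)
    & forall E : comAlgType R, is_pth_root_ring p E ->
        exists phi : {linear E -> R^o},
          (forall r : R, phi r%:A = r) /\
          forall n z, pth_roots p (I (n * p + 1)%N) z -> I n.+1 (phi z)].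

Definition symbolic_F_split (p : nat) I : Prop :=
  F_split_filtration p (symbolic_power I).

End Ideals.

(* Existence of R^{1/p}: the ring R itself, as an R-algebra via Frobenius. *)
Definition frob_alg (R : comNzRingType) (p : nat) (hp : p \in [pchar R]) : Type :=
  R.

Section FrobAlg.
Variables (R : comNzRingType) (p : nat) (hp : p \in [pchar R]).
Local Notation F := (frob_alg hp).

HB.instance Definition _ := GRing.ComNzRing.on F.

Definition frob_scale (r : R) (z : F) : F := (pFrobenius_aut hp r : F) * z.

Fact frob_scaleA a b v : frob_scale a (frob_scale b v) = frob_scale (a * b) v.
Proof. by rewrite /frob_scale mulrA rmorphM. Qed.
Fact frob_scale1 : left_id 1 frob_scale.
Proof. by move=> v; rewrite /frob_scale rmorph1 mul1r. Qed.
Fact frob_scaleDr : right_distributive frob_scale +%R.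
Proof. by move=> a u v; rewrite /frob_scale mulrDr. Qed.
Fact frob_scaleDl v : {morph frob_scale^~ v : a b / a + b}.
Proof. by move=> a b; rewrite /frob_scale rmorphD mulrDl. Qed.
HB.instance Definition _ := GRing.Zmodule_isLmodule.Build R F
  frob_scaleA frob_scale1 frob_scaleDr frob_scaleDl.

Fact frob_scaleAl (a : R) (u v : F) : a *: (u * v) = (a *: u) * v.
Proof. exact: mulrA. Qed.
HB.instance Definition _ := GRing.Lmodule_isLalgebra.Build R F frob_scaleAl.

Fact frob_scaleAr (a : R) (u v : F) : a *: (u * v) = u * (a *: v).
Proof. exact: mulrCA. Qed.
HB.instance Definition _ := GRing.Lalgebra_isAlgebra.Build R F frob_scaleAr.

Lemma is_pth_root_ring_frob :
  (forall (a : R) m, a ^+ m = 0 -> a = 0) ->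
  is_pth_root_ring p (frob_alg hp : comAlgType R).
Proof.
move=> redR.
have algE (r : R) : r%:A = (r ^+ p : F) by exact: mulr1.
split=> [a b | | r | z].
- rewrite /= !algE => eqab; apply/subr0_eq/(redR _ p).
  by rewrite -[LHS](pFrobenius_autE hp) rmorphB /= !pFrobenius_autE eqab subrr.
- exact: redR.
- by exists (r : F); rewrite algE.
- by exists (z : R); rewrite algE.
Qed.

End FrobAlg.

Record sgraph (V : finType) := SGraph {
  adj :> rel V;
  adj_sym : ssrbool.symmetric adj;
  adj_irr : irreflexive adj
}.

Definition graph_iso (V W : finType) (H : sgraph V) (G : sgraph W) : Prop :=
  exists2 h : V -> W, bijective h & forall a b, G (h a) (h b) = H a b.

Section PathGraph.
Variable m : nat.
Definition path_adj : rel 'I_m := fun i j => (i.+1 == j :> nat) || (j.+1 == i :> nat).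
Fact path_adj_sym : ssrbool.symmetric path_adj.
Proof. by move=> i j; rewrite /path_adj orbC. Qed.
Fact path_adj_irr : irreflexive path_adj.
Proof. by move=> i; rewrite /path_adj orbb gtn_eqF. Qed.
Definition path_graph : sgraph 'I_m := SGraph path_adj_sym path_adj_irr.
End PathGraph.

(* Adds r new pairwise adjacent vertices, all adjacent to each vertex of A and to
   no other vertex of H.  The clique join of K_t on H is the case A = {v},
   r = t - 1 or A = {w1, w2}, r = t - 2. *)
Section CliqueJoin.
Variables (V : finType) (H : sgraph V) (A : {set V}) (r : nat).
Definition join_adj : rel (V + 'I_r) := fun a b =>
  match a, b with
  | inl x, inl y => H x y
  | inl x, inr _ | inr _, inl x => x \in A
  | inr i, inr j => i != j
  end.
Fact join_adj_sym : ssrbool.symmetric join_adj.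
Proof. by move=> [x|i] [y|j] //=; [exact: adj_sym | rewrite eq_sym]. Qed.
Fact join_adj_irr : irreflexive join_adj.
Proof. by move=> [x|i] /=; [exact: adj_irr | rewrite eqxx]. Qed.
Definition clique_join : sgraph (V + 'I_r)%type := SGraph join_adj_sym join_adj_irr.
End CliqueJoin.

(* [clique_joins H f U]: H is obtained by successive clique joins from the path P
   on the vertices 0, ..., m; f is the embedding of the vertices of P in H, and U
   is the set of the edges of P via which a join has been made. *)
Inductive clique_joins (m : nat) : forall V : finType,
    sgraph V -> ('I_m.+1 -> V) -> {set {set 'I_m.+1}} -> Prop :=
| CJ_path : clique_joins (path_graph m.+1) id set0
| CJ_vertex (V : finType) (H : sgraph V) f U (i : 'I_m.+1) (t : nat) :
    clique_joins H f U -> (2 <= t)%N ->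
    clique_joins (clique_join H [set f i] (t - 1)%N) (inl \o f) U
| CJ_edge (V : finType) (H : sgraph V) f U (i j : 'I_m.+1) (t : nat) :
    clique_joins H f U -> (3 <= t)%N ->
    path_graph m.+1 i j -> [set i; j] \notin U ->
    clique_joins (clique_join H [set f i; f j] (t - 2)%N) (inl \o f)
      ([set i; j] |: U).

Definition gen_pendant_cliques (W : finType) (G : sgraph W) : Prop :=
  exists m (V : finType) (H : sgraph V) (f : 'I_m.+1 -> V) U,
    clique_joins H f U /\ graph_iso H G.

Section BinomialEdgeIdeal.
Variables (k : fieldType) (n : nat).
Definition xvar (i : 'I_n) : {mpoly k[n + n]} := 'X_(lshift n i).
Definition yvar (i : 'I_n) : {mpoly k[n + n]} := 'X_(rshift n i).
Definition edge_binomial (i j : 'I_n) : {mpoly k[n + n]} :=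
  xvar i * yvar j - yvar i * xvar j.
Definition binomial_edge_ideal (G : sgraph 'I_n) : {mpoly k[n + n]} -> Prop :=
  gen_ideal (fun f => exists i j, G i j /\ f = edge_binomial i j).
End BinomialEdgeIdeal.

Arguments binomial_edge_ideal k [n] G _.

(* Main.v *)
(** Write [f_ij] for the binomials.  Order the vertices so that whenever [i, j] is
    an edge, each vertex strictly between [i] and [j] is simplicial and adjacent to
    [i] or [j], and let [f] be the product of the first [y]-variable, of all
    [f_{l,l+1}] (edge or not) and of the last [x]-variable.  Then [f^(p-1)] is
    homogeneous and congruent to the [(p-1)]-st power of the product of all variables
    modulo the [p]-th powers of the variables, so the trace (the [S]-linear map dual to
    that monomial) of [f^(p-1) g] is a splitting [S^(1/p) -> S] as a function of
    [g^(1/p)].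

    Let [P] be a minimal prime of [J = J_G] and let [T] be the set of the [i] with [x_i, y_i]
    in [P].  By minimality each [i] in [T] has two neighbours [j, l] with [f_jl] not in
    [P]; thus [i] is not simplicial, and [x_i, y_i] lie in [J S_P] since
    [x_i f_jl = x_j f_il - x_l f_ij].  It follows that [J S_P] is generated by the [x_i, y_i]
    with [i] in [T] and the [f_{l,l+1}] in [J S_P] with [l, l+1] outside [T].  If there are
    [h] of these elements, then [f] lies in the [h]-th power of the ideal they generate, and
    the pigeonhole principle shows that the trace of [f^(p-1) g] lies in [J^(N+1) S_P]
    for every [g] in [J^(N p + 1) S_P].  No dimension theory enters: symbolic
    powers are handled as intersections of contractions of the [J^m S_P], which by the
    Lasker-Noether theorem is what their definition amounts to. *)

From HB Require Import structures.
Require Import Defs.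
From mathcomp Require Import all_boot all_order all_algebra.
From mathcomp Require Import ring zify boolp.
From mathcomp Require classical_sets.
From mathcomp Require Import mpoly.

Set Implicit Arguments.
Unset Strict Implicit.
Unset Printing Implicit Defensive.

Import Order.TTheory GRing.Theory.
Local Open Scope ring_scope.

(** * Ideals and localization *)

Section IdealTheory.
Variable R : comNzRingType.
Implicit Types (I J K P Q : R -> Prop) (a b c r : R).

Lemma ideal_opp I a : is_ideal I -> I a -> I (- a).
Proof. by move=> [_ _ IM] Ia; rewrite -mulN1r; exact: IM. Qed.

Lemma ideal_sub I a b : is_ideal I -> I a -> I b -> I (a - b).
Proof. by move=> hI Ia Ib; case: (hI) => _ ID _; apply: ID => //; exact: ideal_opp. Qed.

Lemma ideal_mulr I a r : is_ideal I -> I a -> I (a * r).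
Proof. by move=> [_ _ IM] Ia; rewrite mulrC; exact: IM. Qed.

Lemma ideal_sum (T : Type) (s : seq T) (D : pred T) (F : T -> R) I :
  is_ideal I -> (forall i, D i -> I (F i)) -> I (\sum_(i <- s | D i) F i).
Proof. by move=> [I0 ID _] IF; elim/big_ind: _. Qed.

Lemma gen_ideal_is_ideal (A : R -> Prop) : is_ideal (gen_ideal A).
Proof.
split=> [I [] // | a b ha hb I hI AI | r a ha I hI AI].
- by case: (hI) => _ ID _; apply: ID; [exact: ha | exact: hb].
- by case: (hI) => _ _ IM; apply: IM; exact: ha.
Qed.

Lemma gen_ideal_sub (A : R -> Prop) : sub_set A (gen_ideal A).
Proof. by move=> a Aa I _; apply. Qed.

Lemma ideal_pow_is_ideal I m : is_ideal (ideal_pow I m).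
Proof. by case: m => [|m]; [split | exact: gen_ideal_is_ideal]. Qed.

Lemma ideal_mul_mem I J a b : I a -> J b -> ideal_mul I J (a * b).
Proof. by move=> Ia Jb; apply: gen_ideal_sub; exists a, b. Qed.

Lemma ideal_mul_le I J K : is_ideal K ->
  (forall a b, I a -> J b -> K (a * b)) -> sub_set (ideal_mul I J) K.
Proof. by move=> hK IJK c; apply=> // _ [a [b [Ia Jb ->]]]; exact: IJK. Qed.

Lemma ideal_pow1 I a : I a -> ideal_pow I 1 a.
Proof. by move=> Ia; rewrite -[a]mulr1; exact: ideal_mul_mem. Qed.

Lemma ideal_powD I m l a b :
  ideal_pow I m a -> ideal_pow I l b -> ideal_pow I (m + l) (a * b).
Proof.
move=> + Ib; elim: m a => [|m IHm] a.
  by move=> _; case: (ideal_pow_is_ideal I l) => _ _; apply.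
move=> Ia; suff: is_ideal (fun a => ideal_pow I (m.+1 + l) (a * b)).
  move=> hK; move: a Ia; apply: (ideal_mul_le hK) => a1 a2 Ia1 Ia2.
  by rewrite -mulrA; apply: ideal_mul_mem => //; exact: IHm.
have [I0 ID IM] := ideal_pow_is_ideal I (m.+1 + l).
split=> [|a1 a2 h1 h2|r a1 h1]; rewrite ?mul0r ?mulrDl -?mulrA //.
- exact: ID.
- exact: IM.
Qed.

Lemma ideal_powX I m a e : ideal_pow I m a -> ideal_pow I (m * e) (a ^+ e).
Proof.
move=> Ia; elim: e => [|e IHe]; first by rewrite muln0.
by rewrite mulnS exprS; exact: ideal_powD.
Qed.

Lemma ideal_powS I m : sub_set (ideal_pow I m.+1) (ideal_pow I m).
Proof.
apply: ideal_mul_le; first exact: ideal_pow_is_ideal.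
by move=> a b _ Ib; case: (ideal_pow_is_ideal I m) => _ _; apply.
Qed.

Lemma ideal_pow_leq I m l : (m <= l)%N -> sub_set (ideal_pow I l) (ideal_pow I m).
Proof.
move=> /subnKC <-; elim: (l - m)%N => [|d IHd] a; rewrite ?addn0 // addnS.
by move=> /ideal_powS /IHd.
Qed.

Lemma ideal_pow_base I m : is_ideal I -> (0 < m)%N -> sub_set (ideal_pow I m) I.
Proof.
move=> hI; case: m => // m _; apply: (ideal_mul_le hI) => a b Ia _.
exact: ideal_mulr.
Qed.

Lemma ideal_pow_sub I J m : sub_set I J -> sub_set (ideal_pow I m) (ideal_pow J m).
Proof.
move=> IJ; elim: m => [|m IHm] //.
apply: ideal_mul_le; first exact: ideal_pow_is_ideal.
by move=> a b Ia Ib; apply: ideal_mul_mem; [exact: IJ | exact: IHm].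
Qed.

Lemma ideal_pow_exp I m a : I a -> ideal_pow I m (a ^+ m).
Proof. by move=> Ia; have := ideal_powX m (ideal_pow1 Ia); rewrite mul1n. Qed.

Lemma radical_is_ideal I : is_ideal I -> is_ideal (radical I).
Proof.
move=> hI; have [I0 ID IM] := hI; split; first by exists 1%N.
- move=> a b [m Ia] [l Ib]; exists (m + l)%N.
  rewrite exprDn; apply: ideal_sum => // i _; rewrite -mulr_natr.
  apply: ideal_mulr => //; have [le_il|lt_li] := leqP i l.
    by apply: ideal_mulr => //; rewrite -addnBA // exprD; exact: ideal_mulr.
  by rewrite -(subnKC (ltnW lt_li)) exprD; apply: (IM); exact: ideal_mulr.
- by move=> r a [m Ia]; exists m; rewrite exprMn; exact: IM.
Qed.

Lemma prime_exp P a m : is_prime_ideal P -> P (a ^+ m) -> P a.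
Proof.
move=> [_ P1 PM]; elim: m => [/P1 //|m IHm]; rewrite exprS.
by case/PM.
Qed.

Lemma prime_prod P (T : finType) (D : pred T) (F : T -> R) : is_prime_ideal P ->
  (forall i, D i -> ~ P (F i)) -> ~ P (\prod_(i | D i) F i).
Proof.
move=> [_ P1 PM] PF; elim/big_ind: _ => // a b Pa Pb /PM [] //.
Qed.

Lemma radical_primary_prime Q : is_primary_ideal Q -> is_prime_ideal (radical Q).
Proof.
move=> [hQ Q1 QM]; split; first exact: radical_is_ideal.
  by move=> [m]; rewrite expr1n.
move=> a b [m]; rewrite exprMn => /QM [Qa|[l]]; first by left; exists m.
by rewrite -exprM => Qb; right; exists (m * l)%N.
Qed.

(* The contraction to [R] of the localization of [J] at [P]. *)
Definition local_ideal P J : R -> Prop := fun a => exists2 s, ~ P s & J (s * a).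

Lemma local_is_ideal P J : is_prime_ideal P -> is_ideal J -> is_ideal (local_ideal P J).
Proof.
move=> [_ P1 PM] hJ; have [J0 JD JM] := hJ; split.
- by exists 1; rewrite ?mulr0.
- move=> a b [s Ps Ja] [t Pt Jb]; exists (s * t); first by case/PM.
  rewrite mulrDr; apply: JD; last by rewrite -mulrA; exact: JM.
  by rewrite mulrAC; exact: ideal_mulr.
- by move=> r a [s Ps Ja]; exists s => //; rewrite mulrCA; exact: JM.
Qed.

Lemma local_mem P J : is_prime_ideal P -> sub_set J (local_ideal P J).
Proof. by move=> [_ P1 _] a Ja; exists 1; rewrite ?mul1r. Qed.

Lemma local_sub P I J : sub_set I J -> sub_set (local_ideal P I) (local_ideal P J).
Proof. by move=> IJ a [s Ps Ia]; exists s => //; exact: IJ. Qed.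

(** An element outside [P] is a unit after localization, so it cancels: it is absorbed into the
    denominator. *)
Lemma local_unit P J s a : is_prime_ideal P -> ~ P s ->
  local_ideal P J (s * a) -> local_ideal P J a.
Proof.
move=> [_ _ PM] Ps [t Pt Ja]; exists (t * s); last by rewrite -mulrA.
by case/PM.
Qed.

Lemma local_pow P J m : is_prime_ideal P ->
  sub_set (ideal_pow (local_ideal P J) m) (local_ideal P (ideal_pow J m)).
Proof.
move=> hP; elim: m => [|m IHm]; first by move=> a _; exact: local_mem.
apply: ideal_mul_le; first exact/local_is_ideal/ideal_pow_is_ideal.
move=> a b [s Ps Ja] /IHm [t Pt Jb]; exists (s * t).
  by case: hP => _ _ PM; case/PM.
by rewrite mulrACA; exact: ideal_mul_mem.
Qed.

(** Lets generators that are valid only after localization be exchanged inside every power: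
    [local_pow] collects the denominators of the factors and [local_unit] cancels [s]. *)
Lemma local_pow_trans P I J m : is_prime_ideal P -> sub_set I (local_ideal P J) ->
  sub_set (local_ideal P (ideal_pow I m)) (local_ideal P (ideal_pow J m)).
Proof.
move=> hP IJ a [s Ps Ia]; apply: (local_unit hP Ps).
exact/(local_pow hP)/(ideal_pow_sub IJ).
Qed.

End IdealTheory.

(** * Primary decomposition and symbolic powers *)

Section PrimaryDecomposition.
Variable R : comNzRingType.
Implicit Types (I J K P Q : R -> Prop) (a b c r : R).

Definition noetherian : Prop := forall I : nat -> R -> Prop,
  (forall i, is_ideal (I i)) -> (forall i, sub_set (I i) (I i.+1)) ->
  exists i, sub_set (I i.+1) (I i).

(** Without a maximal member, choice puts a strictly larger member above each one, and iterating
    from [I0] builds a chain that never stops. *)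
Lemma noetherian_maximal (F : (R -> Prop) -> Prop) I0 : noetherian ->
  (forall I, F I -> is_ideal I) -> F I0 ->
  exists2 I, F I & forall J, F J -> sub_set I J -> sub_set J I.
Proof.
move=> noeth Fideal FI0; apply: contrapT => nomax.
have step (I : {I | F I}) :
    {J : {J | F J} | sub_set (sval I) (sval J) /\ ~ sub_set (sval J) (sval I)}.
  apply: cid; case: I => I FI; apply: contrapT => noJ; apply: nomax.
  exists I => // J FJ IJ; apply: contrapT => nJI; apply: noJ.
  by exists (exist _ J FJ).
pose chain i := iter i (fun I : {I | F I} => sval (step I)) (exist _ I0 FI0).
have [i|i|i] := noeth (fun i => sval (chain i)).
- exact/Fideal/svalP.
- by case: (svalP (step (chain i))).
- by case: (svalP (step (chain i))).
Qed.

Definition primary_decomposition J s (Q : 'I_s -> R -> Prop) : Prop :=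
  (forall i, is_primary_ideal (Q i)) /\ eq_set J (fun a => forall i, Q i a).

Definition colon I b : R -> Prop := fun a => I (a * b).

Lemma colon_is_ideal I b : is_ideal I -> is_ideal (colon I b).
Proof.
move=> [I0 ID IM]; split=> [|a c Ia Ic|r a Ia]; rewrite /colon ?mul0r ?mulrDl //.
  exact: ID.
by rewrite -mulrA; exact: IM.
Qed.

Definition add_principal I b : R -> Prop := fun a => exists2 c, I c & exists r, a = c + r * b.

Lemma add_principal_is_ideal I b : is_ideal I -> is_ideal (add_principal I b).
Proof.
move=> [I0 ID IM]; split.
- by exists 0 => //; exists 0; rewrite mul0r addr0.
- move=> _ _ [c1 I1 [r1 ->]] [c2 I2 [r2 ->]]; exists (c1 + c2); first exact: ID.
  by exists (r1 + r2); ring.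
- move=> r _ [c Ic [s ->]]; exists (r * c); first exact: IM.
  by exists (r * s); ring.
Qed.

Lemma primary_decomposition_cap I J K s t (Q : 'I_s -> R -> Prop) (L : 'I_t -> R -> Prop) :
  primary_decomposition I Q -> primary_decomposition J L ->
  eq_set K (fun a => I a /\ J a) ->
  exists u (M : 'I_u -> R -> Prop), primary_decomposition K M.
Proof.
move=> [Qp QE] [Lp LE] KE; exists (s + t)%N.
exists (fun i => match split i with inl j => Q j | inr j => L j end); split.
  by move=> i; case: split.
move=> a; rewrite (KE a) (QE a) (LE a); split.
  by move=> [Qa La] i; case: split.
move=> Ma; split=> i; first by have := Ma (lshift t i); rewrite (unsplitK (inl i)).
by have := Ma (rshift s i); rewrite (unsplitK (inr i)).
Qed.

(* If [a b] lies in [J], [a] does not and no power of [b] does, and the chain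
   [J : b^i] stops at [i], then [J] is the intersection of the strictly larger
   ideals [J : b^i] and [J + (b^i)]. *)
Lemma primary_decomposition_exists J : noetherian -> is_ideal J ->
  exists s (Q : 'I_s -> R -> Prop), primary_decomposition J Q.
Proof.
move=> noeth hJ; apply: contrapT => nodec.
pose F I := is_ideal I /\ ~ exists s (Q : 'I_s -> R -> Prop), primary_decomposition I Q.
have [I [hI nI] Imax] := noetherian_maximal (F := F) noeth (fun _ => @proj1 _ _) (conj hJ nodec).
have larger K x : is_ideal K -> sub_set I K -> K x -> ~ I x ->
    exists s (Q : 'I_s -> R -> Prop), primary_decomposition K Q.
  move=> hK IK Kx Ix; apply: contrapT => nK; apply: Ix.
  exact: (Imax K (conj hK nK) IK).
have [I0 ID IM] := hI; apply: nI.
have [I1|I1] := EM (I 1).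
  exists 0%N, (fun _ => I); split=> [[] // | a]; split=> [_ [] // | _].
  by rewrite -[a]mulr1; exact: IM.
have [Ipr|Inpr] := EM (is_primary_ideal I).
  exists 1%N, (fun _ => I); split=> [//|a]; split=> [//|]; exact: (@^~ ord0).
have [a [b [Iab Ia Ib]]] : exists a b, [/\ I (a * b), ~ I a & ~ radical I b].
  apply: contrapT => nab; apply: Inpr; split=> // a b Iab.
  have [Ia|Ia] := EM (I a); first by left.
  by right; apply: contrapT => Ib; apply: nab; exists a, b.
have [i|i x|i stop] := noeth (fun i => colon I (b ^+ i.+1)).
- exact: colon_is_ideal.
- by rewrite /colon [b ^+ i.+2]exprSr mulrA => Ix; exact: ideal_mulr.
pose e := b ^+ i.+1.
have stopn l : sub_set (colon I (b ^+ (l + i.+1))) (colon I e).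
  elim: l => [|l IHl] x //; rewrite /colon addSn exprS mulrA => Ix.
  have {Ix} : colon I (b ^+ i.+2) x.
    by rewrite /colon exprS mulrA; exact: IHl.
  exact: stop.
have [] := larger (colon I e) a => //.
- exact: colon_is_ideal.
- by move=> x Ix; exact: ideal_mulr.
- by rewrite /colon /e exprS mulrA; exact: ideal_mulr.
move=> s [Q dQ]; have [] := larger (add_principal I e) e => //.
- exact: add_principal_is_ideal.
- by move=> x Ix; exists x => //; exists 0; rewrite mul0r addr0.
- by exists 0 => //; exists 1; rewrite mul1r add0r.
- by move=> Ie; apply: Ib; exists i.+1.
move=> t [L dL]; apply: (primary_decomposition_cap dQ dL) => x; split.
  move=> Ix; split; first exact: ideal_mulr.
  by exists x => //; exists 0; rewrite mul0r addr0.
move=> [Ixe [c Ic [r xE]]]; rewrite xE; apply: ID => //.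
apply: (stopn i.+1); rewrite /colon exprD -/e mulrA.
suff ->: r * e * e = x * e - c * e by apply: ideal_sub => //; exact: ideal_mulr.
by rewrite xE; ring.
Qed.

Lemma primary_decomposition_remove J s (Q : 'I_s.+1 -> R -> Prop) i :
  primary_decomposition J Q -> sub_set (fun a => forall j, j != i -> Q j a) (Q i) ->
  primary_decomposition J (Q \o lift i).
Proof.
move=> [Qp QE] Qi; split=> [j|a]; first exact: Qp.
rewrite (QE a); split=> [Qa j|Qa j]; first exact: Qa.
have Q'a l : l != i -> Q l a.
  by rewrite eq_sym => /unlift_some [l' -> _]; exact: Qa.
by have [->|] := eqVneq j i; [exact: Qi | exact: Q'a].
Qed.

Lemma primary_cap Q Q' : is_primary_ideal Q -> is_primary_ideal Q' ->
  eq_set (radical Q) (radical Q') ->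
  is_primary_ideal (fun a => Q a /\ Q' a).
Proof.
move=> [hQ Q1 QM] [hQ' Q1' QM'] eqrad; split.
- case: hQ hQ' => [Q0 QD QZ] [Q0' QD' QZ']; split=> //.
    by move=> a b [? ?] [? ?]; split; [exact: QD | exact: QD'].
  by move=> r a [? ?]; split; [exact: QZ | exact: QZ'].
- by case.
move=> a b [Qab Q'ab].
have both : radical Q b -> radical (fun a => Q a /\ Q' a) b.
  move=> Qb; have [m Qm] := Qb; have [l Ql] := proj1 (eqrad b) Qb.
  exists (m + l)%N; rewrite exprD; split; first exact: ideal_mulr.
  by rewrite mulrC; exact: ideal_mulr.
have [Qa|/both] := QM _ _ Qab; last by right.
have [Q'a|/(proj2 (eqrad b))/both] := QM' _ _ Q'ab; last by right.
by left.
Qed.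

(** A decomposition with the fewest components is minimal: a redundant component could be dropped,
    and two components with the same radical could be merged. *)
Lemma min_primary_decomposition_exists J : noetherian -> is_ideal J ->
  exists s (Q : 'I_s -> R -> Prop), is_min_primary_decomposition J Q.
Proof.
move=> noeth hJ; have exdec := primary_decomposition_exists noeth hJ.
pose D s := `[< exists Q : 'I_s -> R -> Prop, primary_decomposition J Q >].
have exD : exists s, D s by case: exdec => s [Q dQ]; exists s; apply/asboolP; exists Q.
case: (ex_minnP exD) => -[|s] /asboolP [Q dQ] smin.
  by exists 0%N, Q; case: dQ => Qp QE; split=> // -[].
have irred (L : 'I_s.+1 -> R -> Prop) i : primary_decomposition J L ->
    ~ sub_set (fun a => forall j, j != i -> L j a) (L i).
  move=> dL /(primary_decomposition_remove dL) dL'.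
  have /smin : D s by apply/asboolP; exists (L \o lift i).
  by rewrite ltnn.
exists s.+1, Q; case: (dQ) => Qp QE; split=> // [i j neij eqrad|i]; last exact: irred.
(* Intersecting component [j] with [Q i] makes component [i] redundant. *)
pose L l a := Q l a /\ (l = j -> Q i a).
apply: (irred L i); last first.
  move=> a La; have [|_ /(_ erefl) Qia] := La j; first by rewrite eq_sym.
  by split=> // eij; rewrite eij eqxx in neij.
split=> [l|a].
  have [->|nelj] := eqVneq l j.
    have -> : L j = fun a => Q j a /\ Q i a.
      by apply/funext => a; apply/propext; split=> [] [? H]; split=> //; exact: H.
    by apply: primary_cap => // a; rewrite (eqrad a).
  have -> : L l = Q l; last by [].
  apply/funext => a; apply/propext; split=> [[] //|? ]; split=> //.
  by move=> elj; rewrite elj eqxx in nelj.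
rewrite (QE a); split=> [Qa l|La l]; first by split.
by case: (La l).
Qed.

Variables (J P : R -> Prop).
Hypothesis hP : is_minimal_prime J P.

(** Some component lies in [P], since otherwise a product of elements outside [P], one from each
    component, would lie in [J]. Its radical is [P] by minimality. As radicals are distinct, every
    other component meets the complement of [P] and becomes the unit ideal on localizing. *)
Lemma min_prime_component m s (Q : 'I_s -> R -> Prop) : is_ideal J -> (0 < m)%N ->
  is_min_primary_decomposition (ideal_pow J m) Q ->
  exists2 i, eq_set (radical (Q i)) P &
    eq_set (Q i) (local_ideal P (ideal_pow J m)).
Proof.
move=> hJ m0 [Qp QE radne _]; have [primeP JP Pmin] := hP.
have [_ P1 PM] := primeP.
have Q_ge l a : J a -> radical (Q l) a.
  by move=> Ja; exists m; move: l; rewrite -[forall l, _](QE (a ^+ m)); exact: ideal_pow_exp.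
have rad_eq l : sub_set (Q l) P -> eq_set (radical (Q l)) P.
  move=> QlP.
  have radP : sub_set (radical (Q l)) P by move=> a [e /QlP /prime_exp]; apply.
  move=> a; split; first exact: radP.
  by apply: (Pmin _ _ _ radP); [exact: radical_primary_prime | exact: Q_ge].
have [i QiP] : exists i, sub_set (Q i) P.
  apply: contrapT => nQ.
  have outP i : {b | Q i b /\ ~ P b}.
    apply: cid; apply: contrapT => nb; apply: nQ; exists i => b Qb.
    by apply: contrapT => nPb; apply: nb; exists b.
  have : P (\prod_i sval (outP i)).
    apply/JP/(ideal_pow_base hJ m0)/(QE _) => i.
    rewrite (bigD1 i) //=; case: (outP i) => b [Qb _] /=.
    by apply: ideal_mulr => //; case: (Qp i).
  by apply: prime_prod => // i _; case: (svalP (outP i)).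
exists i; first exact: rad_eq.
have outP l : {b | l != i -> Q l b /\ ~ P b}.
  apply: cid; have [_|neli] := eqVneq l i; first by exists 0.
  apply: contrapT => nb; have QlP : sub_set (Q l) P.
    by move=> b Qb; apply: contrapT => nPb; apply: nb; exists b.
  apply: (radne _ _ neli) => a; rewrite (rad_eq _ QlP a).
  by have := rad_eq _ QiP a; tauto.
move=> a; split=> [Qia|[b Pb Jba]].
  exists (\prod_(l | l != i) sval (outP l)).
    by apply: prime_prod => // l neli; case: (svalP (outP l) neli).
  apply/(QE _) => l; have [hQ _ _] := Qp l; have [eli|neli] := eqVneq l i.
    by subst l; case: hQ => _ _; apply.
  rewrite (bigD1 l) //=; case: (svalP (outP l) neli) => Qb _.
  by apply: ideal_mulr => //; exact: ideal_mulr.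
have [_ _ QM] := Qp i; move/(QE _)/(_ i): Jba; rewrite mulrC => /QM [//|].
by case=> e /QiP /prime_exp Pb'; case: Pb; exact: Pb'.
Qed.

End PrimaryDecomposition.

(** By [min_prime_component] any [P]-primary component is the contraction, distinct radicals
    singling out its index. Existence of a decomposition serves the forward direction, where a
    component must be supplied. *)
Lemma symbolic_powerE (R : comNzRingType) (J : R -> Prop) m a : noetherian R ->
  is_ideal J ->
  symbolic_power J m a <->
  forall P, is_minimal_prime J P -> local_ideal P (ideal_pow J m) a.
Proof.
move=> noeth hJ; case: m => [|m].
  by split=> // _ P [primeP _ _]; exact: local_mem.
split=> [Ja P hP|locJ P q hP [s [Q [dQ [i [radQi Qiq]]]]]].
  have [s [Q dQ]] := min_primary_decomposition_exists noeth (ideal_pow_is_ideal J m.+1).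
  have [i radQi QiE] := min_prime_component hP hJ (ltn0Sn m) dQ.
  apply/(QiE a)/(Ja P (Q i)) => //; exists s, Q; split=> //; exists i; split=> // x.
have [i' radQi' Qi'E] := min_prime_component hP hJ (ltn0Sn m) dQ.
apply/(Qiq a); suff -> : i = i' by exact/(Qi'E a)/locJ.
apply: contrapT => /eqP neii'; case: dQ => _ _ /(_ _ _ neii') + _; apply.
by move=> x; rewrite (radQi x) (radQi' x).
Qed.

Lemma symbolic_power_filtration (R : comNzRingType) (J : R -> Prop) :
  noetherian R -> is_ideal J ->
  [/\ forall m, is_ideal (symbolic_power J m),
      forall m, sub_set (symbolic_power J m.+1) (symbolic_power J m)
    & forall m l, sub_set (ideal_mul (symbolic_power J m) (symbolic_power J l))
                          (symbolic_power J (m + l))].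
Proof.
move=> noeth hJ; have E := symbolic_powerE _ _ noeth hJ.
have hS m : is_ideal (symbolic_power J m).
  have hL P : is_minimal_prime J P -> is_ideal (local_ideal P (ideal_pow J m)).
    by move=> [hP _ _]; exact/local_is_ideal/ideal_pow_is_ideal.
  split=> [|a b /E Sa /E Sb|r a /E Sa]; apply/E => P hP; have [L0 LD LM] := hL P hP => //.
    by apply: LD; [exact: Sa | exact: Sb].
  by apply: LM; exact: Sa.
split=> // [m a /E Sa|m l].
  by apply/E => P /Sa; apply: local_sub; exact: ideal_powS.
apply: ideal_mul_le => // a b /E Sa /E Sb; apply/E => P hP.
have [s Ps Ja] := Sa P hP; have [t Pt Jb] := Sb P hP.
exists (s * t); first by case: hP => -[_ _ PM] _ _; case/PM.
by rewrite mulrACA; exact: ideal_powD.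
Qed.

(** * Polynomial rings are Noetherian *)

(** Each new index is one where [v] is least beyond the previous index. *)
Lemma monotone_subsequence (v : nat -> nat) :
  exists2 f : nat -> nat, {homo f : i j / (i < j)%N} & {homo v \o f : i j / (i <= j)%N}.
Proof.
have argmin N : {i | (N <= i)%N /\ forall j, (N <= j)%N -> (v i <= v j)%N}.
  apply: cid; pose D t := `[< exists2 i, (N <= i)%N & v i = t >].
  have exD : exists t, D t by exists (v N); apply/asboolP; exists N.
  case: (ex_minnP exD) => _ /asboolP [i Ni <-] vmin; exists i; split=> // j Nj.
  by apply: vmin; apply/asboolP; exists j.
pose f := fix f k := if k is k'.+1 then sval (argmin (f k').+1) else sval (argmin 0%N).
have fS k : (f k < f k.+1)%N by case: (svalP (argmin (f k).+1)).
exists f; first by apply: homo_ltn => // ? ? ?; exact: ltn_trans.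
apply: homo_leq => //=; first by move=> ? ? ?; exact: leq_trans.
move=> [|k].
  by case: (svalP (argmin 0%N)) => _; exact.
by case: (svalP (argmin (f k).+1)) => _; apply; exact: ltn_trans (fS k.+1).
Qed.

(** Successive subsequences make the coordinates monotone one at a time; the first two terms of the
    last one are then comparable. *)
Lemma dickson n (u : nat -> 'X_{1..n}) :
  exists i j, (i < j)%N /\ (u i <= u j)%MM.
Proof.
suff sub k : exists2 f : nat -> nat, {homo f : i j / (i < j)%N} &
    forall c : 'I_n, (c < k)%N -> {homo (fun i => u (f i) c) : i j / (i <= j)%N}.
  have [f fmono uf] := sub n.
  by exists (f 0%N), (f 1%N); split; [exact: fmono | apply/mnm_lepP => c; exact: uf].
elim: k => [|k [f fmono uf]]; first by exists id.
have [ltkn|] := ltnP k n; last first.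
  by move=> lenk; exists f => // c _; apply: uf; exact: leq_trans lenk.
have [g gmono ug] := monotone_subsequence (fun i => u (f i) (Ordinal ltkn)).
exists (f \o g) => [i j ij|c]; first exact/fmono/gmono.
rewrite ltnS leq_eqVlt => /orP [/eqP ck|ck] i j ij /=.
  have -> : c = Ordinal ltkn by exact: val_inj.
  exact: ug.
apply: (uf c) => //; move: ij; rewrite leq_eqVlt => /orP [/eqP -> //|/gmono].
exact: ltnW.
Qed.

Lemma mlead_reduce (k : fieldType) n (f g : {mpoly k[n]}) : f != 0 -> g != 0 ->
  (mlead f <= mlead g)%MM ->
  exists h, g - h * f = 0 \/ (mlead (g - h * f) < mlead g)%O.
Proof.
move=> f0 g0 le_fg; set c := mleadc g / mleadc f.
have lf0 : mleadc f != 0 by rewrite mleadc_eq0.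
have lg0 : mleadc g != 0 by rewrite mleadc_eq0.
have c0 : c != 0 by rewrite mulf_neq0 ?invr_neq0.
pose h := c *: 'X_[mlead g - mlead f]; exists h.
have hf : h * f = c *: (f * 'X_[mlead g - mlead f]) by rewrite -scalerAl mulrC.
have X0 : 'X_[mlead g - mlead f] != 0 :> {mpoly k[n]} by rewrite -msupp_eq0 msuppX.
have lead_hf : mlead (h * f) = mlead g.
  by rewrite hf mleadZ // mleadM // mleadXm addmC submK.
have [->|gh0] := eqVneq (g - h * f) 0; first by left.
right; rewrite lt_neqAle; apply/andP; split; last first.
  by have := mleadB_le g (h * f); rewrite lead_hf joinxx.
apply: contraNneq gh0 => lead_eq; rewrite -mleadc_eq0 lead_eq mcoeffB hf mcoeffZ.
have := mcoeffMX f (mlead g - mlead f) (mlead f); rewrite submK // => ->.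
by rewrite /c divfK // subrr.
Qed.

(** In a chain that never stops, choose in each [I i.+1] outside [I i] an element with least leading
    monomial. By Dickson's lemma one of these leading monomials divides a later one; reducing the
    later element by the earlier one contradicts its choice. *)
Lemma mpoly_noetherian (k : fieldType) n : noetherian {mpoly k[n]}.
Proof.
move=> I hI Imono; apply: contrapT => nostop.
have le_I i j : (i <= j)%N -> sub_set (I i) (I j).
  by move=> /subnKC <-; elim: (j - i)%N => [|d IHd] a; rewrite ?addn0 // addnS => /IHd /Imono.
have minlead i : {f | [/\ I i.+1 f, ~ I i f &
    forall g, I i.+1 g -> ~ I i g -> ~ (mlead g < mlead f)%O]}.
  apply: cid; apply: contrapT => nomin; apply: nostop; exists i => f.
  move: {2}(mlead f) (erefl (mlead f)) => m; elim/(@ltmwf n): m f => m IHm f fm If.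
  apply: contrapT => nIf; apply: nomin; exists f; split=> // g Ig nIg.
  by rewrite fm => /IHm /(_ _ erefl Ig).
pose f i := sval (minlead i).
have f0 i : f i != 0.
  apply/eqP => fi0; case: (svalP (minlead i)) => _ + _.
  by rewrite -/(f i) fi0; case: (hI i).
have [i [j [ltij lead_ij]]] := dickson (fun i => mlead (f i)).
have [h red] := mlead_reduce (f0 i) (f0 j) lead_ij.
have [If _ _] := svalP (minlead i); have [Jf nJf fmin] := svalP (minlead j).
have Jhf : I j (h * f i) by case: (hI j) => _ _; apply; exact: le_I If.
have nJg : ~ I j (f j - h * f i).
  move=> Jg; apply: nJf; rewrite -/(f j) -(subrK (h * f i) (f j)).
  by case: (hI j) => _ JD _; exact: JD.
case: red => [g0|]; first by apply: nJg; rewrite g0; case: (hI j).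
by apply: fmin => //; apply: ideal_sub => //; exact: Imono.
Qed.

(** * The trace map *)

Lemma pnat_pchar (R : comNzRingType) p : p \in [pchar R] -> [pchar R].-nat p.
Proof. by move=> hp; rewrite pnatE ?(pcharf_prime hp). Qed.

(* A maximal [k^p]-subspace of [k] that avoids [1] is a complement of [k^p]. *)
Lemma frobenius_retraction (k : fieldType) (p : nat) : p \in [pchar k] ->
  exists lam : k -> k, [/\ forall a b, lam (a + b) = lam a + lam b, lam 1 = 1
    & forall c d, lam (c ^+ p * d) = c * lam d].
Proof.
move=> hp; have p_gt0 : (0 < p)%N by rewrite prime_gt0 // (pcharf_prime hp).
have expD (a b : k) : (a + b) ^+ p = a ^+ p + b ^+ p by rewrite exprDn_pchar // pnat_pchar.
have expN (a : k) : (- a) ^+ p = - a ^+ p by rewrite exprNn_pchar // pnat_pchar.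
pose isub (W : k -> Prop) := [/\ forall a b, W a -> W b -> W (a + b),
  forall c a, W a -> W (c ^+ p * a) & ~ W 1].
have [F subF totF|W [[WD WM W1] Wmax]] := classical_sets.Zorn_bigcup (P := isub).
  split=> [a b [A FA Aa] [B FB Bb]|c a [A FA Aa]|[A /subF [_ _ A1] //]].
    have [AB|BA] := totF A B FA FB.
      by exists B => //; case: (subF B FB) => BD _ _; apply: BD => //; exact: AB.
    by exists A => //; case: (subF A FA) => AD _ _; apply: AD => //; exact: BA.
  by exists A => //; case: (subF A FA) => _ AM _; exact: AM.
have {}Wmax (B : k -> Prop) x : (forall a, W a -> B a) -> B x -> isub B -> W x.
  move=> WB Bx hB; apply: contrapT => nWx; apply: (Wmax B) => //; split=> [//|].
  by move/(_ x Bx).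
(* [isub] admits the empty set, so that the union of an empty chain qualifies in Zorn's lemma; that
   0 is in [W] comes from maximality. *)
have W0 : W 0.
  apply: (Wmax (fun x => W x \/ x = 0)); [by left | by right |].
  split=> [a b [Wa|->] [Wb|->]|c a [Wa|->]|[//|]]; rewrite ?addr0 ?add0r ?mulr0.
  - by left; exact: WD.
  - by left.
  - by left.
  - by right.
  - by left; exact: WM.
  - by right.
  - by move/eqP; rewrite oner_eq0.
have WN a : W a -> W (- a).
  by move=> Wa; rewrite -mulN1r -[X in - X](expr1n k p) -expN; exact: WM.
have lamP d : {c | W (d - c ^+ p)}.
  (* If the span [B] of [W] and [d] avoids 1, then [d] is in [W] and the root 0 works. Otherwise
     [1 = w + c ^+ p * d] with [c] nonzero, and [c^-1] works. *)
  apply: cid; pose B x := exists w c, W w /\ x = w + c ^+ p * d.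
  have [[w [c [Ww E1]]]|B1] := EM (B 1); last first.
    exists 0; rewrite expr0n gtn_eqF // subr0; apply: (Wmax B).
    - by move=> a Wa; exists a, 0; rewrite expr0n gtn_eqF // mul0r addr0.
    - by exists 0, 1; rewrite expr1n mul1r add0r.
    split=> // [_ _ [w1 [c1 [W1' ->]]] [w2 [c2 [W2 ->]]]|c _ [w [e [Ww ->]]]].
      exists (w1 + w2), (c1 + c2); split; first exact: WD.
      by rewrite expD; ring.
    exists (c ^+ p * w), (c * e); split; first exact: WM.
    by rewrite exprMn; ring.
  have c0 : c != 0.
    apply/eqP => c0; apply: W1; rewrite E1 c0 expr0n gtn_eqF // mul0r addr0.
    exact: Ww.
  exists c^-1; have -> : d - c^-1 ^+ p = - (c^-1 ^+ p * w); last exact/WN/WM.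
  have cp0 : c ^+ p != 0 by rewrite expf_neq0.
  have -> : w = 1 - c ^+ p * d by rewrite [X in X - _]E1 addrK.
  by rewrite exprVn mulrBr mulr1 mulKf // opprB.
(* Two different roots would put a nonzero [p]-th power in [W], hence 1 after scaling. *)
have lam_uniq d c : W (d - c ^+ p) -> sval (lamP d) = c.
  move=> Wc; apply/eqP; rewrite -subr_eq0; apply/negPn/negP => e0.
  have {}Wc : W ((sval (lamP d) - c) ^+ p).
    have -> : (sval (lamP d) - c) ^+ p = (d - c ^+ p) - (d - sval (lamP d) ^+ p).
      by rewrite expD expN; ring.
    by apply: WD => //; apply: WN; exact: svalP (lamP d).
  by apply: W1; have := WM (sval (lamP d) - c)^-1 _ Wc; rewrite exprVn mulVf // expf_neq0.
exists (fun d => sval (lamP d)); split=> [a b||c d]; apply: lam_uniq.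
- rewrite expD opprD addrACA; exact: WD (svalP (lamP a)) (svalP (lamP b)).
- by rewrite expr1n subrr.
- by rewrite exprMn -mulrBr; apply: WM; exact: (svalP (lamP d)).
Qed.

Lemma mcoeffM_monomial (R : comNzRingType) n (g : {mpoly R[n]}) (d m : 'X_{1..n}) :
  (g * 'X_[d])@_m = if (d <= m)%MM then g@_(m - d) else 0.
Proof.
case: ifPn => [le_dm|nle]; first by rewrite -{1}(submK le_dm) addmC mcoeffMX.
apply/eqP; rewrite mcoeff_eq0; apply: contra nle.
rewrite (perm_mem (msuppMX _ _)) => /mapP [m' _ ->].
exact: lem_addr.
Qed.

Section Trace.
Variables (k : fieldType) (p n : nat) (lam : k -> k).
Hypothesis hp : p \in [pchar k].
Hypothesis lamD : forall a b, lam (a + b) = lam a + lam b.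
Hypothesis lamM : forall c d, lam (c ^+ p * d) = c * lam d.
Implicit Types (g r : {mpoly k[n]}) (m : 'X_{1..n}).

Definition trace_exponent m : 'X_{1..n} := [multinom (m i * p + p.-1)%N | i < n].

(** Cutting at [msize g] makes the sum finite and loses nothing: [trace_exponent m] has at least the
    degree of [m], so beyond the cut the coefficient is 0, and [lam] kills it. *)
Definition trace g : {mpoly k[n]} :=
  \sum_(m : 'X_{1..n < msize g}) lam (g@_(trace_exponent m)) *: 'X_[m].

Let p_gt0 : (0 < p)%N. Proof. by rewrite prime_gt0 // (pcharf_prime hp). Qed.

Lemma retraction0 : lam 0 = 0.
Proof. by apply: (addrI (lam 0)); rewrite -lamD !addr0. Qed.

Lemma mcoeff_trace g m : (trace g)@_m = lam g@_(trace_exponent m).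
Proof.
have [lt_m|le_m] := ltnP (mdeg m) (msize g); first
  exact: (mcoeff_mpoly (fun m => lam g@_(trace_exponent m))).
rewrite [g@__]memN_msupp_eq0 ?retraction0.
  rewrite raddf_sum big1 // => -[m' /= lt_m'] _.
  rewrite mcoeffZ mcoeffX; case: eqP => [eqm|_]; last exact: mulr0.
  by rewrite eqm ltnNge le_m in lt_m'.
apply: contraL (leq_trans le_m (_ : mdeg m <= mdeg (trace_exponent m))%N) => [/msize_mdeg_lt|].
  by rewrite -ltnNge.
rewrite !mdegE; apply: leq_sum => i _; rewrite mnmE.
by rewrite (leq_trans _ (leq_addr _ _)) // leq_pmulr.
Qed.

Lemma traceD g r : trace (g + r) = trace g + trace r.
Proof. by apply/mpolyP => m; rewrite mcoeffD !mcoeff_trace mcoeffD lamD. Qed.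

Lemma pchar_mpoly : p \in [pchar {mpoly k[n]}].
Proof. by rewrite pchar_lalg. Qed.

Lemma trace0 : trace 0 = 0.
Proof. by apply/mpolyP => m; rewrite mcoeff_trace !mcoeff0 retraction0. Qed.

Lemma trace_frobenius r g : trace (r ^+ p * g) = r * trace g.
Proof.
elim/mpolyind: r => [|c a r _ _ IHr].
  by rewrite expr0n gtn_eqF // !mul0r trace0.
have pnatp := pnat_pchar pchar_mpoly.
rewrite (exprDn_pchar _ _ pnatp) mulrDl traceD {}IHr mulrDl.
congr (_ + _).
apply/mpolyP => m; rewrite mcoeff_trace exprZn mpolyXn.
rewrite -!scalerAl !mcoeffZ lamM; congr (_ * _).
rewrite [_ * g]mulrC [_ * trace g]mulrC !mcoeffM_monomial mcoeff_trace.
(* Adding [p - 1] to [m i * p] does not reach the next multiple of [p]. *)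
have -> : (a *+ p <= trace_exponent m)%MM = (a <= m)%MM.
  apply/mnm_lepP/mnm_lepP => le i; have := le i; rewrite mulmnE mnmE.
    by rewrite -ltnS -addnS prednK // -mulSnr ltn_pmul2r.
  by move=> lei; rewrite (leq_trans _ (leq_addr _ _)) // leq_pmul2r.
case: ifP => [/mnm_lepP le_am|_]; last exact: retraction0.
congr (lam _@__); apply/mnmP => i; rewrite !mnmE mulmnE.
by rewrite mulnBl addnBAC // leq_pmul2r.
Qed.

End Trace.

(** [phi z] is [psi] of [z ^+ p] read in [R]. Pulling [p]-th powers out of [psi] becomes linearity
    of [phi], and [psi 1 = 1] makes it a splitting. *)
Lemma pth_root_splitting (R : comNzRingType) p (psi : R -> R) (E : comAlgType R) :
  p \in [pchar R] ->
  (forall a b, psi (a + b) = psi a + psi b) ->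
  (forall r a, psi (r ^+ p * a) = r * psi a) ->
  psi 1 = 1 -> is_pth_root_ring p E ->
  exists phi : {linear E -> R^o},
    (forall r, phi r%:A = r) /\ forall z a, z ^+ p = a%:A -> phi z = psi a.
Proof.
move=> hp psiD psiM psi1 [injA _ _ exA].
have hpE : p \in [pchar E] by exact: rmorph_pchar (in_alg E) _ hp.
pose tau z := sval (cid (exA z)).
have tauP z a : z ^+ p = a%:A -> tau z = a.
  by move=> za; apply: injA; rewrite /= -za /tau; case: cid.
have tauE z : z ^+ p = (tau z)%:A by rewrite /tau; case: cid.
have lin : linear (psi \o tau : E -> R^o).
  move=> r z w; suff: psi (tau (r *: z + w)) = r * psi (tau z) + psi (tau w) by [].
  rewrite -psiM -psiD.
  congr psi; apply: tauP; rewrite (exprDn_pchar _ _ (pnat_pchar hpE)).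
  by rewrite exprZn !tauE scalerA scalerDl.
pose L := GRing.isLinear.Build _ _ _ _ _ lin.
pose phi : {linear E -> R^o} := HB.pack (psi \o tau : E -> R^o) L.
exists phi; split=> [r|z a za] /=.
  by rewrite (tauP _ (r ^+ p)) ?exprZn ?expr1n //; have := psiM r 1; rewrite !mulr1 psi1 mulr1.
by rewrite (tauP _ _ za).
Qed.

(** * The trace map and powers of a finitely generated ideal *)

Section FrobeniusContainment.
Variables (R : comNzRingType) (s : seq R).
Let K : R -> Prop := gen_ideal (fun a => a \in s).
Let h : 'I_(size s) -> R := tnth (in_tuple s).

Let monomial_ideal M : R -> Prop := gen_ideal (fun a =>
  exists2 e : 'I_(size s) -> nat, (\sum_i e i = M)%N & a = \prod_i h i ^+ e i).

Lemma ideal_pow_monomials M : sub_set (ideal_pow K M) (monomial_ideal M).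
Proof.
elim: M => [|M IHM] a.
  move=> _; rewrite -[a]mulr1.
  have [_ _ GM] := gen_ideal_is_ideal (fun a =>
    exists2 e : 'I_(size s) -> nat, (\sum_i e i = 0)%N & a = \prod_i h i ^+ e i).
  apply: GM; apply: gen_ideal_sub; exists (fun=> 0%N); first by rewrite big1.
  by rewrite big1.
have hG := gen_ideal_is_ideal (fun a =>
  exists2 e : 'I_(size s) -> nat, (\sum_i e i = M.+1)%N & a = \prod_i h i ^+ e i).
apply: (ideal_mul_le hG) => {}a b Ka /IHM Gb {IHM}.
(* Colon ideals express that membership of a product is linear in each factor: first [a], then [b],
   may be taken among the generators. *)
suff : colon (monomial_ideal M.+1) b a by [].
apply: (Ka _ (colon_is_ideal b hG)) => {Ka} _ /(tnthP (in_tuple s)) [i ->].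
rewrite /colon mulrC; suff : colon (monomial_ideal M.+1) (h i) b by [].
apply: (Gb _ (colon_is_ideal _ hG)) => {Gb} _ [e eM ->].
apply: gen_ideal_sub; exists (fun j => e j + (j == i))%N.
  by rewrite big_split /= eM -big_mkcond /= big_pred1_eq addn1.
rewrite [RHS](eq_bigr (fun j => h j ^+ e j * h j ^+ (j == i))); last first.
  by move=> j _ /=; rewrite exprD.
rewrite big_split /=; congr (_ * _).
rewrite (bigD1 i) //= eqxx expr1 big1 ?mulr1 // => j /negbTE ->.
exact: expr0.
Qed.

Lemma monomial_ideal_pow (e : 'I_(size s) -> nat) :
  ideal_pow K (\sum_i e i) (\prod_i h i ^+ e i).
Proof.
elim/big_rec2: _ => [|i N a _ IH] //; apply: ideal_powD => //.
by apply: ideal_pow_exp; apply: gen_ideal_sub; exact: mem_tnth.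
Qed.

Variables (p : nat) (tr : R -> R).
Hypothesis p_gt0 : (0 < p)%N.
Hypothesis trD : forall a b, tr (a + b) = tr a + tr b.
Hypothesis trM : forall r a, tr (r ^+ p * a) = r * tr a.

(* By the pigeonhole principle a monomial of degree [size s * (p - 1) + N * p + 1]
   in the generators is a multiple of the [p]-th power of one of degree [N + 1]. *)
Lemma trace_ideal_pow N a c : ideal_pow K (size s * p.-1 + N * p + 1) a ->
  ideal_pow K N.+1 (tr (c * a)).
Proof.
have [K0 KD KM] := ideal_pow_is_ideal K N.+1.
have tr0 : tr 0 = 0 by apply: (addrI (tr 0)); rewrite -trD !addr0.
move=> /ideal_pow_monomials Ga; move: c.
suff: is_ideal (fun a => forall c, ideal_pow K N.+1 (tr (c * a))).
  move=> hI; refine (Ga _ hI _) => {Ga hI} _ [e eM ->] c.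
  have -> : c * \prod_i h i ^+ e i =
      (\prod_i h i ^+ (e i %/ p)%N) ^+ p * (c * \prod_i h i ^+ (e i %% p)%N).
    rewrite mulrCA -prodrXl -big_split /=; congr (_ * _).
    by apply: eq_bigr => i _; rewrite -exprM -exprD -divn_eq.
  rewrite trM mulrC; apply: (KM).
  apply: (ideal_pow_leq (l := \sum_i (e i %/ p)%N)); last exact: monomial_ideal_pow.
  (* The remainders modulo [p] add up to at most [size s * p.-1], so the quotients account for more
     than [N * p] and their sum exceeds [N]. *)
  rewrite -(ltn_pmul2r p_gt0) -(ltn_add2l (size s * p.-1)).
  rewrite -addn1 -eM.
  apply: leq_trans (_ : \sum_i (e i %/ p * p + e i %% p) <= _)%N.
    by apply: leq_sum => i _; rewrite -divn_eq.
  rewrite big_split /= addnC big_distrl /= leq_add2r.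
  apply: leq_trans (_ : \sum_(i < size s) p.-1 <= _)%N; last first.
    by rewrite sum_nat_const card_ord.
  by apply: leq_sum => i _; rewrite -ltnS prednK // ltn_mod.
split=> [c|a1 a2 I1 I2 c|r a1 I1 c]; rewrite ?mulr0 ?tr0 ?mulrDr ?trD ?mulrA //.
exact: KD.
Qed.

Lemma trace_symbolic N f g : ideal_pow K (size s) f -> ideal_pow K (N * p + 1) g ->
  ideal_pow K N.+1 (tr (f ^+ p.-1 * g)).
Proof.
move=> Kf Kg; rewrite -[_ * g]mul1r; apply: trace_ideal_pow.
by rewrite -addnA; apply: ideal_powD => //; exact: ideal_powX.
Qed.

(* Localizing at the minimal primes, the hypothesis is that [J] is generated by
   [size s] elements and contains [f] in its power of exponent [size s]. *)
Lemma trace_local P (J : R -> Prop) N f g : is_prime_ideal P ->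
  sub_set J (local_ideal P K) -> (forall a, a \in s -> local_ideal P J a) ->
  is_ideal J ->
  ideal_pow K (size s) f -> local_ideal P (ideal_pow J (N * p + 1)) g ->
  local_ideal P (ideal_pow J N.+1) (tr (f ^+ p.-1 * g)).
Proof.
move=> primeP JK sJ hJ Kf Jg.
have KJ : sub_set K (local_ideal P J) by move=> a; apply=> //; exact: local_is_ideal.
have [t Pt Kg] := local_pow_trans primeP JK Jg.
(* The denominator [t] enters the trace as [t ^+ p]; one of its factors brings [g] into the power of
   [K]. *)
apply: (local_unit primeP Pt); rewrite -trM.
apply: (local_pow_trans primeP KJ); apply: local_mem => //.
have -> : t ^+ p * (f ^+ p.-1 * g) = f ^+ p.-1 * (t ^+ p.-1 * (t * g)).
  by rewrite mulrCA [t ^+ p.-1 * _]mulrA -exprSr prednK.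
apply: trace_symbolic => //.
by have [_ _ KM] := ideal_pow_is_ideal K (N * p + 1); exact: KM.
Qed.

End FrobeniusContainment.

(** * The product along a path *)

Section PathProduct.
Variables (k : fieldType) (n : nat) (sigma : nat -> 'I_n).
Local Notation S := {mpoly k[n + n]}.
Local Notation x i := (xvar k i).
Local Notation y i := (yvar k i).

Fixpoint half_path_product N : S :=
  if N is N'.+1 then half_path_product N' * edge_binomial k (sigma N') (sigma N)
  else y (sigma 0).

Definition path_product N : S := half_path_product N * x (sigma N).

Lemma half_path_product_homog N : half_path_product N \is (N.*2.+1).-homog.
Proof.
have hvar (i : 'I_(n + n)) : ('X_i : S) \is 1.-homog by rewrite dhomogX /= mdeg1.
have hmul (i j : 'I_(n + n)) : ('X_i * 'X_j : S) \is 2.-homog by exact: (dhomogM (hvar i) (hvar j)).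
elim: N => [|N IHN] /=; first exact: hvar.
by rewrite doubleS -addn2; apply: dhomogM => //; apply: rpredB; exact: hmul.
Qed.

Lemma path_product_homog N : path_product N \is (N.+1.*2).-homog.
Proof.
rewrite doubleS -addn1; apply: dhomogM; first exact: half_path_product_homog.
by rewrite dhomogX /= mdeg1.
Qed.

Section LeadingTerm.
Variable p : nat.
Hypothesis p_gt0 : (0 < p)%N.

(* It is generated by the [p]-th powers of the variables. *)
Definition high_ideal (q : S) : Prop := forall m : 'X_{1..n + n}, (forall i, m i < p)%N -> q@_m = 0.

Lemma high_ideal_is_ideal : is_ideal high_ideal.
Proof.
split=> [m _|a b Ia Ib m mp|r a Ia m mp]; first exact: mcoeff0.
  by rewrite mcoeffD Ia // Ib // addr0.
rewrite mcoeffM big1 // => -[m1 m2] /= /eqP mE; rewrite [a@__]Ia ?mulr0 // => i.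
apply: leq_ltn_trans (mp i).
by rewrite [leqRHS](congr1 (fun m : 'X_{1..n + n} => m i) mE) mnmDE leq_addl.
Qed.

Lemma high_ideal_var (i : 'I_(n + n)) : high_ideal ('X_i ^+ p).
Proof.
move=> m mp; rewrite mcoeffXn; case: eqP => // mE.
by have := mp i; rewrite -mE mulmnE mnm1E eqxx mul1n ltnn.
Qed.

(** By induction, with the new binomial written [A - B * X]: every term of its power other than
    [A ^+ p.-1] contains [X], which with the final factor [X ^+ p.-1] gives a [p]-th power of a
    variable. *)
Lemma path_product_exp N : high_ideal
  (path_product N ^+ p.-1 - \prod_(l < N.+1) (x (sigma l) * y (sigma l)) ^+ p.-1).
Proof.
have [I0 ID IM] := high_ideal_is_ideal.
elim: N => [|N IHN].
  by rewrite big_ord_recl big_ord0 mulr1 /path_product /= mulrC subrr.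
rewrite big_ord_recr /=; set Q := \prod_(_ < _) _ in IHN *.
pose X := x (sigma N.+1); pose Y := y (sigma N.+1).
pose A := x (sigma N) * Y; pose B := y (sigma N); pose H := half_path_product N.
have [q Bq] : exists q, (A - B * X) ^+ p.-1 = A ^+ p.-1 + X * q.
  exists (- (B * \sum_(i < p.-1) (A - B * X) ^+ (p.-1.-1 - i) * A ^+ i)).
  apply/(addIr (- A ^+ p.-1)); rewrite subrXX; ring.
have -> : path_product N.+1 = X * (H * (A - B * X)) by exact: mulrC.
rewrite !exprMn Bq.
have -> : X ^+ p.-1 * (H ^+ p.-1 * (A ^+ p.-1 + X * q)) - Q * (X ^+ p.-1 * Y ^+ p.-1) =
    (X ^+ p.-1 * Y ^+ p.-1) * (path_product N ^+ p.-1 - Q) + (H ^+ p.-1 * q) * (X ^+ p.-1 * X).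
  by rewrite /A /path_product !exprMn; ring.
by apply: ID; apply: IM => //; rewrite -exprSr prednK //; exact: high_ideal_var.
Qed.

End LeadingTerm.

Hypothesis sigma_inj : {in gtn n &, injective sigma}.

Lemma prod_sigma (G : 'I_n -> S) : \prod_(l < n) G (sigma l) = \prod_i G i.
Proof.
rewrite [RHS](reindex (fun l : 'I_n => sigma l)) //.
apply/onW_bij/injF_bij => l l' eqs; apply: val_inj.
by apply: sigma_inj => //; exact: ltn_ord.
Qed.

(** The power is homogeneous of degree [2n(p - 1)], which is the degree of [trace_exponent p m] only
    for [m = 0]. There [path_product_exp] gives the coefficient 1. *)
Lemma trace_path_product p lam (lam1 : lam 1 = 1)
    (lamD : forall a b, lam (a + b) = lam a + lam b) :
  p \in [pchar k] -> (0 < n)%N -> trace p lam (path_product n.-1 ^+ p.-1) = 1.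
Proof.
move=> hp n_gt0; have p_gt0 : (0 < p)%N by rewrite prime_gt0 // (pcharf_prime hp).
apply/mpolyP => m; rewrite (mcoeff_trace hp) // mcoeff1.
have [->|m0] := eqVneq m 0%MM; last first.
  rewrite (dhomog_nemf_coeff (dhomogMn _ (path_product_homog _))) ?(retraction0 lamD) //.
  rewrite /= prednK // mdegE; under eq_bigr => i _ do rewrite mnmE.
  rewrite big_split /= sum_nat_const card_ord -big_distrl /= -mdegE -addnn.
  by rewrite -[X in _ != X]add0n eqn_add2r muln_eq0 negb_or mdeg_eq0 m0 -lt0n.
have := path_product_exp p_gt0 n.-1 (m := trace_exponent p 0%MM).
rewrite mcoeffB => /(_ _)/subr0_eq -> => [|i]; last first.
  by rewrite mnmE mnm0E mul0n add0n prednK.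
rewrite prednK // (prod_sigma (fun i => (x i * y i) ^+ p.-1)).
rewrite (_ : \prod_i _ = 'X_[trace_exponent p 0%MM]) ?mcoeffX ?eqxx //.
rewrite mpolyXE_id big_split_ord /= -big_split /=; apply: eq_bigr => i _.
by rewrite !mnmE exprMn.
Qed.

Section Membership.
Variables (T : pred 'I_n) (e : pred nat).
Hypothesis eT : forall l, e l -> ~~ T (sigma l) && ~~ T (sigma l.+1).

Definition vertex_gens i : seq S := if T i then [:: x i; y i] else [::].

(** A list, because its length is the exponent in [path_product_mem]; [nseq] with a boolean count
    inserts a binomial or nothing. *)
Fixpoint path_gens N : seq S :=
  if N is N'.+1 then
    path_gens N' ++ nseq (e N') (edge_binomial k (sigma N') (sigma N)) ++ vertex_gens (sigma N)
  else vertex_gens (sigma 0).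

Lemma path_gens_vertex N l : (l <= N)%N -> T (sigma l) ->
  x (sigma l) \in path_gens N /\ y (sigma l) \in path_gens N.
Proof.
move=> + Tl.
have vl : x (sigma l) \in vertex_gens (sigma l) /\ y (sigma l) \in vertex_gens (sigma l).
  by rewrite /vertex_gens Tl !inE !eqxx orbT.
elim: N => [|N IHN]; first by rewrite leqn0 => /eqP l0; move: vl; rewrite l0.
rewrite leq_eqVlt => /orP [/eqP lN|/IHN []]; rewrite /= !mem_cat.
  by case: vl; rewrite lN => -> ->; rewrite !orbT.
by move=> -> ->.
Qed.

Lemma path_gens_edge N l : (l < N)%N -> e l ->
  edge_binomial k (sigma l) (sigma l.+1) \in path_gens N.
Proof.
move=> + el; elim: N => [|N IHN] //; rewrite ltnS leq_eqVlt => /orP [/eqP lN|/IHN].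
  by rewrite /= !mem_cat -lN el mem_seq1 eqxx orbT.
by rewrite /= mem_cat => ->.
Qed.

Lemma path_gens_ind N (Q : S -> Prop) :
  (forall l, (l <= N)%N -> T (sigma l) -> Q (x (sigma l)) /\ Q (y (sigma l))) ->
  (forall l, (l < N)%N -> e l -> Q (edge_binomial k (sigma l) (sigma l.+1))) ->
  forall a, a \in path_gens N -> Q a.
Proof.
move=> Qv Qe; have Qvl l a : (l <= N)%N -> a \in vertex_gens (sigma l) -> Q a.
  rewrite /vertex_gens => lN; case: ifP => // /(Qv _ lN) [Qx Qy].
  by rewrite !inE => /orP [] /eqP ->.
move=> a; elim: {-2}N (leqnn N) => [_|N' IHN' N'N] /=; first exact: Qvl.
rewrite !mem_cat => /or3P [||]; [exact/IHN'/ltnW | | exact: Qvl].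
by rewrite mem_nseq => /andP [eN' /eqP ->]; apply: Qe => //; case: (e N') eN'.
Qed.

(** Each vertex of [T] adds two generators and is met by two consecutive factors, the end variables
    serving the first and the last vertex. Each edge of [e] adds one generator, its own factor,
    which by [eT] is not also counted for a vertex. *)
Lemma path_product_mem N (K : S -> Prop) : (forall a, a \in path_gens N -> K a) ->
  ideal_pow K (size (path_gens N)) (path_product N).
Proof.
move=> gK.
have Kv l : (l <= N)%N -> ideal_pow K (T (sigma l)) (x (sigma l)) /\
                         ideal_pow K (T (sigma l)) (y (sigma l)).
  move=> lN; case Tl: (T (sigma l)) => //.
  by have [xl yl] := path_gens_vertex lN Tl; split; apply: ideal_pow1; exact: gK.
(* The half product has met its last vertex only once; the next factor supplies the second
   contribution. *)
suff [d sz Kd] : exists2 d, size (path_gens N) = (d + T (sigma N))%N &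
    ideal_pow K d (half_path_product N).
  by rewrite sz; apply: (ideal_powD (m := d)) => //; case: (Kv N).
have szv i : size (vertex_gens i) = (T i + T i)%N by rewrite /vertex_gens; case: (T i).
elim: {-2}N (leqnn N) => [N0|N' IHN' N'N] /=.
  by exists (T (sigma 0)) => //; case: (Kv 0%N).
have [d sz Kd] := IHN' (ltnW N'N).
exists (d + (T (sigma N') + T (sigma N'.+1) + e N'))%N.
  by rewrite !size_cat sz szv size_nseq; lia.
apply: (ideal_powD (m := d)) => //; case eN': (e N').
  have /andP [/negbTE -> /negbTE ->] := eT eN'.
  exact: ideal_pow1 (gK _ (path_gens_edge N'N eN')).
have [Kx Ky] := Kv _ (ltnW N'N); have [Kx' Ky'] := Kv _ N'N.
rewrite addn0; apply: ideal_sub; first exact: ideal_pow_is_ideal.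
  exact: ideal_powD Kx Ky'.
exact: ideal_powD Ky Kx'.
Qed.

End Membership.
End PathProduct.

(** * Minimal primes of a binomial edge ideal *)

Definition poly_ideal (R : comNzRingType) (P : R -> Prop) : {poly R} -> Prop :=
  fun q => forall i, P q`_i.

(** As in Gauss's lemma: if [i] and [j] are the lowest degrees with coefficients outside [P], the
    coefficient of degree [i + j] of the product is outside [P]. *)
Lemma poly_ideal_prime (R : comNzRingType) (P : R -> Prop) :
  is_prime_ideal P -> is_prime_ideal (poly_ideal P).
Proof.
move=> [hP P1 PM]; have [P0 PD PZ] := hP; split.
- split=> [i|q r Pq Pr i|r q Pq i]; rewrite ?coef0 ?coefD //; first exact: PD.
  by rewrite coefM; apply: ideal_sum => // j _; exact: PZ.
- by move/(_ 0%N); rewrite coef1.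
move=> q r Pqr; apply: contrapT => /not_orP [nq nr].
have minout (u : {poly R}) : ~ poly_ideal P u ->
    exists2 i, ~ P u`_i & forall j, (j < i)%N -> P u`_j.
  move=> nu; have exi : exists i, `[< ~ P u`_i >].
    apply: contrapT => nex; apply: nu => i; apply: contrapT => Pi; apply: nex.
    by exists i; apply/asboolP.
  case: (ex_minnP exi) => i /asboolP Pi imin; exists i => // j ltji.
  by apply: contrapT => /asboolP /imin; rewrite leqNgt ltji.
have [i Pi imin] := minout q nq; have [j Pj jmin] := minout r nr.
have := Pqr (i + j)%N; rewrite coefM.
have lti : (i < (i + j).+1)%N by rewrite ltnS leq_addr.
rewrite (bigD1 (Ordinal lti)) //= addKn.
set rest := \sum_(_ | _) _ => Psum.
have Prest : P rest.
  apply: ideal_sum => // l nel; have [ltli|leil] := ltnP l i.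
    by apply: ideal_mulr => //; exact: imin.
  have ltil : (i < l)%N by rewrite ltn_neqAle leil andbT eq_sym.
  by apply: PZ; apply: jmin; have := ltn_ord l; lia.
suff /PM [] : P (q`_i * r`_j) by [].
by rewrite -(addrK rest (q`_i * _)); exact: ideal_sub.
Qed.

Lemma poly_ideal_polyC (R : comNzRingType) (P : R -> Prop) c :
  is_ideal P -> P c -> poly_ideal P c%:P.
Proof. by move=> [P0 _ _] Pc i; rewrite coefC; case: eqP. Qed.

Lemma poly_ideal_polyCX (R : comNzRingType) (P : R -> Prop) c :
  is_ideal P -> poly_ideal P (c%:P * 'X) <-> P c.
Proof.
move=> [P0 _ _]; split=> [/(_ 1%N)|Pc i]; first by rewrite coefMX coefC.
by rewrite coefMX coefC; case: eqP => // _; case: eqP.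
Qed.

Section BinomialEdgeIdealLocal.
Variables (k : fieldType) (n : nat) (G : sgraph 'I_n).
Local Notation S := {mpoly k[n + n]}.
Local Notation J := (binomial_edge_ideal k G).
Local Notation x i := (@xvar k n i).
Local Notation y i := (@yvar k n i).
Local Notation f i j := (@edge_binomial k n i j).

Lemma edge_binomialC i j : f j i = - f i j.
Proof. rewrite /edge_binomial; ring. Qed.

Lemma edge_binomial_id i : f i i = 0.
Proof. rewrite /edge_binomial; ring. Qed.

Lemma edge_binomial_syzygy_x i j l : x i * f j l = x j * f i l - x l * f i j.
Proof. rewrite /edge_binomial; ring. Qed.

Lemma edge_binomial_syzygy_y i j l : y i * f j l = y j * f i l - y l * f i j.
Proof. rewrite /edge_binomial; ring. Qed.

Lemma binomial_edge_ideal_is_ideal : is_ideal J.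
Proof. exact: gen_ideal_is_ideal. Qed.

Lemma binomial_edge_ideal_edge i j : G i j -> J (f i j).
Proof. by move=> Gij; apply: gen_ideal_sub; exists i, j. Qed.

Variable P : S -> Prop.
Hypothesis hP : is_minimal_prime J P.
Let primeP : is_prime_ideal P. Proof. by case: hP. Qed.

Definition both_vars_in i : bool := `[< P (x i) /\ P (y i) >].

(* Otherwise the neighbours of [i] would share, modulo [P], a direction [(a, b)];
   the substitution [x i -> a t], [y i -> b t] would then pull back [P[t]] to a
   prime ideal between [J] and [P] not containing both [x i] and [y i]. *)
Lemma minimal_prime_cut i : both_vars_in i ->
  exists j l, [/\ G i j, G i l & ~ P (f j l)].
Proof.
move=> /asboolP [Px Py]; apply: contrapT => nocut.
have nbrs j l : G i j -> G i l -> P (f j l).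
  by move=> Gij Gil; apply: contrapT => Pf; apply: nocut; exists j, l.
have [hPi P1 PM] := primeP; have [P0 PD PZ] := hPi; have [_ JP Pmin] := hP.
(* The direction is that of a neighbour whose variables are not both in [P]; if there is none, any
   pair outside [P] serves. *)
have [a [b [Pab dir]]] : exists a b : S, ~ (P a /\ P b) /\
    forall l, G i l -> P (a * y l - b * x l).
  have [[j [Gij Pj]]|allin] := EM (exists j, G i j /\ ~ (P (x j) /\ P (y j))).
    by exists (x j), (y j); split=> // l; exact: nbrs.
  exists 1, 1; split=> [[] //|l Gil]; rewrite !mul1r.
  have [? ?] : P (x l) /\ P (y l) by apply: contrapT => Pl; apply: allin; exists l.
  exact: ideal_sub.
pose h (v : 'I_(n + n)) : {poly S} :=
  if v == lshift n i then a%:P * 'X else if v == rshift n i then b%:P * 'X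
  else ('X_v)%:P.
have [alpha [alphaC alphaX]] : exists alpha : {rmorphism S -> {poly S}},
    (forall c, alpha c%:MP = c%:MP%:P) /\ forall v, alpha 'X_v = h v.
  exists (mmap (polyC \o @mpolyC (n + n) k) h); split=> [c|v] /=; first exact: mmapC.
  by rewrite mmapX mmap1U.
have alphax j : alpha (x j) = if j == i then a%:P * 'X else (x j)%:P.
  by rewrite alphaX /h (inj_eq (@lshift_inj _ _)) eq_lrshift.
have alphay j : alpha (y j) = if j == i then b%:P * 'X else (y j)%:P.
  by rewrite alphaX /h eq_rlshift (inj_eq (@rshift_inj _ _)).
pose Q g := poly_ideal P (alpha g).
have [[PX0 PXD PXZ] PX1 PXM] := poly_ideal_prime primeP.
have idealQ : is_ideal Q.
  split=> [|g1 g2 Q1 Q2|r g Qg]; rewrite /Q.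
  - by rewrite rmorph0.
  - by rewrite rmorphD; exact: PXD.
  - by rewrite rmorphM; exact: PXZ.
have primeQ : is_prime_ideal Q.
  split; [exact: idealQ | by rewrite /Q rmorph1 |].
  by move=> g1 g2; rewrite /Q rmorphM => /PXM.
have QiN l : G i l -> Q (f i l).
  move=> Gil; have neli : l != i by apply: contraTneq Gil => ->; rewrite adj_irr.
  rewrite /Q rmorphB !rmorphM !alphax !alphay eqxx (negbTE neli).
  have -> : a%:P * 'X * (y l)%:P - b%:P * 'X * (x l)%:P = (a * y l - b * x l)%:P * 'X.
    by rewrite polyCB !polyCM; ring.
  exact/(poly_ideal_polyCX _ hPi)/dir.
have JQ : sub_set J Q.
  move=> g Jg; refine (Jg _ idealQ _) => _ [j [l [Gjl ->]]].
  have [eji|neji] := eqVneq j i; first by rewrite eji; apply: QiN; rewrite -eji.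
  have [eli|neli] := eqVneq l i.
    rewrite edge_binomialC; apply: (ideal_opp idealQ); rewrite eli; apply: QiN.
    by rewrite adj_sym -eli.
  rewrite /Q rmorphB !rmorphM !alphax !alphay (negbTE neji) (negbTE neli).
  rewrite -!polyCM -polyCB; apply: (poly_ideal_polyC hPi).
  exact: JP _ (binomial_edge_ideal_edge Gjl).
have QP : sub_set Q P.
  (* Setting [t = 0] after the substitution only replaces [x i] and [y i], which lie in [P], by 0,
     so it changes nothing modulo [P]. *)
  pose C g := P (g - (alpha g)`_0).
  have CD g1 g2 : C g1 -> C g2 -> C (g1 + g2).
    by rewrite /C rmorphD coefD opprD addrACA; exact: PD.
  have CM g1 g2 : C g1 -> C g2 -> C (g1 * g2).
    rewrite /C rmorphM coef0M => C1 C2.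
    have -> : g1 * g2 - (alpha g1)`_0 * (alpha g2)`_0 =
      (alpha g1)`_0 * (g2 - (alpha g2)`_0) + g2 * (g1 - (alpha g1)`_0) by ring.
    by apply: PD; exact: PZ.
  have CC c : C (c%:MP).
    by rewrite /C alphaC coefC subrr.
  have CX v : C 'X_v.
    rewrite /C alphaX /h; case: eqP => [->|_]; first by rewrite coefMX subr0.
    case: eqP => [->|_]; first by rewrite coefMX subr0.
    by rewrite coefC subrr.
  have Call g : C g.
    have C1 : C 1 by rewrite -mpolyC1.
    elim/mpolyind: g => [|c m g _ _ IHg]; first by rewrite -mpolyC0.
    apply: CD IHg; rewrite -mul_mpolyC; apply: (CM _ _ (CC c)).
    rewrite mpolyXE_id; apply: (big_ind C C1 CM) => v _.
    elim: (m v) => [|d IHd]; first by rewrite expr0.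
    by rewrite exprS; exact: CM.
  move=> g Qg; rewrite -(subrK (alpha g)`_0 g); apply: PD; first exact: Call.
  exact: Qg.
(* By minimality [Q] contains [x i] and [y i], whose images are [a t] and [b t]; this forces [a] and
   [b] into [P]. *)
have PQ := Pmin Q primeQ JQ QP; apply: Pab; split.
  by apply/(poly_ideal_polyCX _ hPi); have := PQ _ Px; rewrite /Q alphax eqxx.
by apply/(poly_ideal_polyCX _ hPi); have := PQ _ Py; rewrite /Q alphay eqxx.
Qed.

Definition simplicial i : Prop := forall j l, G i j -> G i l -> j != l -> G j l.

Lemma simplicial_both_vars_in i : simplicial i -> ~~ both_vars_in i.
Proof.
move=> simp; apply/negP => /minimal_prime_cut [j [l [Gij Gil]]]; apply.
have [[P0 _ _] _ _] := primeP.
have [<-|nejl] := eqVneq j l; first by rewrite edge_binomial_id.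
by have [_ JP _] := hP; exact: JP _ (binomial_edge_ideal_edge (simp j l Gij Gil nejl)).
Qed.

Lemma local_var i : both_vars_in i ->
  local_ideal P J (x i) /\ local_ideal P J (y i).
Proof.
move=> /minimal_prime_cut [j [l [Gij Gil Pf]]].
have [J0 JD JM] := binomial_edge_ideal_is_ideal.
have Jj := binomial_edge_ideal_edge Gij; have Jl := binomial_edge_ideal_edge Gil.
have hJ := binomial_edge_ideal_is_ideal.
split; exists (f j l); [exact: Pf | | exact: Pf |]; rewrite mulrC.
  by rewrite edge_binomial_syzygy_x; exact: (ideal_sub hJ (JM _ _ Jl) (JM _ _ Jj)).
by rewrite edge_binomial_syzygy_y; exact: (ideal_sub hJ (JM _ _ Jl) (JM _ _ Jj)).
Qed.

(** One of [x j], [y j] is invertible after localization, and its multiple of [f i l] is given by a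
    syzygy. *)
Lemma local_edge_trans (I : S -> Prop) i j l : is_ideal I -> ~~ both_vars_in j ->
  local_ideal P I (f i j) -> local_ideal P I (f j l) -> local_ideal P I (f i l).
Proof.
move=> hI /asboolPn nj Lij Ljl; have hL := local_is_ideal primeP hI.
have [_ _ LM] := hL.
have Lji : local_ideal P I (f j i) by rewrite edge_binomialC; exact: ideal_opp.
have [Pxj|Pxj] := EM (P (x j)); last first.
  apply: (local_unit primeP Pxj); rewrite edge_binomial_syzygy_x.
  by apply: ideal_sub => //; exact: LM.
have Pyj : ~ P (y j) by move=> Pyj; exact: nj.
apply: (local_unit primeP Pyj); rewrite edge_binomial_syzygy_y.
by apply: ideal_sub => //; exact: LM.
Qed.

End BinomialEdgeIdealLocal.

(** * Vertex orders and generators of the localized ideal *)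

Section CliqueOrder.
Variables (k : fieldType) (n : nat) (G : sgraph 'I_n) (sigma : nat -> 'I_n).
Local Notation S := {mpoly k[n + n]}.
Local Notation J := (binomial_edge_ideal k G).
Local Notation x i := (@xvar k n i).
Local Notation y i := (@yvar k n i).
Local Notation f i j := (@edge_binomial k n i j).

Definition clique_order : Prop := forall a l b : nat, (a < l)%N -> (l < b)%N -> (b < n)%N ->
  G (sigma a) (sigma b) ->
  simplicial G (sigma l) /\ (G (sigma l) (sigma a) \/ G (sigma l) (sigma b)).

Hypothesis sigma_order : clique_order.
Hypothesis sigma_surj : forall i, exists2 a, (a < n)%N & sigma a = i.
Variable P : S -> Prop.
Hypothesis hP : is_minimal_prime J P.
Let primeP : is_prime_ideal P. Proof. by case: hP. Qed.
Let hJ : is_ideal J. Proof. exact: binomial_edge_ideal_is_ideal. Qed.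

Local Notation T := (both_vars_in P).
Local Notation L := (local_ideal P J).

(** The test is membership in the localized ideal, not adjacency: consecutive vertices may be
    related only through a third one. *)
Definition local_step l : bool :=
  [&& ~~ T (sigma l), ~~ T (sigma l.+1) & `[< L (f (sigma l) (sigma l.+1)) >]].

Definition local_gens : seq S := path_gens k sigma T local_step n.-1.

Lemma local_gens_local a : a \in local_gens -> L a.
Proof.
apply: path_gens_ind => [l _|l _ /and3P [_ _ /asboolP]] //.
exact: local_var.
Qed.

(** Vertices between [a] and [b] are simplicial, hence outside [T]. Each is related to [b] by an
    edge or through [a], so consecutive ones are related through [b]. *)
Lemma edge_local_step a b l : (a < b)%N -> (b < n)%N -> G (sigma a) (sigma b) ->
  ~~ T (sigma a) -> ~~ T (sigma b) -> (a <= l)%N -> (l < b)%N -> local_step l.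
Proof.
move=> ltab ltbn Gab Ta Tb leal ltlb.
have LG i j : G i j -> L (f i j).
  by move=> Gij; apply: (local_mem primeP); exact: binomial_edge_ideal_edge.
have hL := local_is_ideal primeP hJ.
have [L0 _ _] := hL.
have trans := local_edge_trans hP hJ.
have nT c : (a <= c)%N -> (c <= b)%N -> ~~ T (sigma c).
  rewrite leq_eqVlt => /orP [/eqP <- //|ltac].
  rewrite leq_eqVlt => /orP [/eqP -> //|ltcb].
  by have [simp _] := sigma_order ltac ltcb ltbn Gab; exact: (simplicial_both_vars_in hP simp).
have to_b c : (a <= c)%N -> (c <= b)%N -> L (f (sigma c) (sigma b)).
  rewrite leq_eqVlt => /orP [/eqP <- _|ltac]; first exact: LG.
  rewrite leq_eqVlt => /orP [/eqP ->|ltcb]; first by rewrite edge_binomial_id.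
  have [_ [Gca|Gcb]] := sigma_order ltac ltcb ltbn Gab; last exact: LG.
  by apply: (trans _ (sigma a)) => //; exact: LG.
apply/and3P; split; [exact: nT (ltnW _) | exact: (nT _ (leqW leal)) |].
apply/asboolP; apply: (trans _ (sigma b)) => //; first exact: to_b (ltnW _).
rewrite edge_binomialC; apply: (ideal_opp hL); exact: to_b (leqW leal) _.
Qed.

(** The binomial of an edge with an end in [T] is a combination of that end's variables; any other
    edge is a chain of local steps, composed by [local_edge_trans]. *)
Lemma local_gens_edges : sub_set J (local_ideal P (gen_ideal (fun a => a \in local_gens))).
Proof.
set K := gen_ideal _.
have hK : is_ideal K by exact: gen_ideal_is_ideal.
have hLK := local_is_ideal primeP hK.
have [LK0 _ LKM] := hLK.
have gK a : a \in local_gens -> local_ideal P K a.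
  by move=> ga; apply: (local_mem primeP); exact: gen_ideal_sub.
have Tvar i : T i -> local_ideal P K (x i) /\ local_ideal P K (y i).
  have [a ltan <-] := sigma_surj i => Ta.
  have lean : (a <= n.-1)%N by lia.
  by have [gx gy] := path_gens_vertex k local_step lean Ta; split; exact: gK.
have Tedge i j : T i -> local_ideal P K (f i j).
  by move=> /Tvar [Kx Ky]; apply: (ideal_sub hLK); rewrite mulrC; exact: LKM.
have edge a b : (a < b)%N -> (b < n)%N -> G (sigma a) (sigma b) ->
    local_ideal P K (f (sigma a) (sigma b)).
  move=> ltab ltbn Gab.
  case Ta: (T (sigma a)); first exact: Tedge.
  case Tb: (T (sigma b)).
    by rewrite edge_binomialC; apply: (ideal_opp hLK); exact: Tedge.
  have step l : (a <= l)%N -> (l < b)%N -> local_step l.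
    by apply: edge_local_step => //; rewrite ?Ta ?Tb.
  have chain d : (a + d <= b)%N -> local_ideal P K (f (sigma a) (sigma (a + d))).
    elim: d => [|d IHd]; first by rewrite addn0 edge_binomial_id.
    rewrite addnS => led; have st := step _ (leq_addr d a) led.
    apply: (local_edge_trans hP hK _ (IHd (ltnW led))); first by case/and3P: st.
    by apply: gK; apply: path_gens_edge => //; lia.
  by have := chain (b - a)%N; rewrite subnKC ?(ltnW ltab) //; apply.
move=> g Jg; refine (Jg _ hLK _) => _ [i [j [Gij ->]]].
have [a ltan ai] := sigma_surj i; have [b ltbn bj] := sigma_surj j.
subst i j; have [ltab|ltba|eqab] := ltngtP a b; first exact: edge.
  by rewrite edge_binomialC; apply: (ideal_opp hLK); apply: edge => //; rewrite adj_sym.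
by rewrite eqab edge_binomial_id.
Qed.

Lemma clique_order_trace (p : nat) (tr : S -> S) N g : (0 < p)%N ->
  (forall a b, tr (a + b) = tr a + tr b) ->
  (forall r a, tr (r ^+ p * a) = r * tr a) ->
  local_ideal P (ideal_pow J (N * p + 1)) g ->
  local_ideal P (ideal_pow J N.+1) (tr (path_product k sigma n.-1 ^+ p.-1 * g)).
Proof.
move=> p_gt0 trD trM Jg.
apply: (trace_local (s := local_gens) p_gt0 trD trM primeP local_gens_edges _ hJ _ Jg).
  exact: local_gens_local.
apply: path_product_mem => [l /and3P [-> ->] //|a ga].
exact: gen_ideal_sub.
Qed.

End CliqueOrder.

Lemma clique_order_symbolic_F_split (k : fieldType) (p : nat) (hp : p \in [pchar k])
    (n : nat) (G : sgraph 'I_n) (sigma : nat -> 'I_n) : (0 < n)%N ->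
  {in gtn n &, injective sigma} -> clique_order G sigma ->
  symbolic_F_split p (binomial_edge_ideal k G).
Proof.
move=> n_gt0 sigma_inj sigma_order.
have sigma_surj i : exists2 a, (a < n)%N & sigma a = i.
  have inj : injective (fun l : 'I_n => sigma l).
    by move=> l l' eqs; apply: val_inj; apply: sigma_inj => //; exact: ltn_ord.
  by exists (invF inj i); [exact: ltn_ord | exact: (f_invF inj i)].
have noeth := @mpoly_noetherian k (n + n).
have hJ := binomial_edge_ideal_is_ideal k G.
have [I_ideal I_anti I_mul] := symbolic_power_filtration noeth hJ.
split=> // E hE.
have [lam [lamD lam1 lamM]] := frobenius_retraction hp.
have p_gt0 : (0 < p)%N by rewrite prime_gt0 // (pcharf_prime hp).
pose F := path_product k sigma n.-1 ^+ p.-1.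
have trD := traceD hp lamD; have trM := trace_frobenius hp lamD lamM.
have [||| |phi [phi1 phiE]] := pth_root_splitting (psi := fun g => trace p lam (F * g)) _ _ _ _ hE.
- exact: pchar_mpoly.
- by move=> a b; rewrite mulrDr; exact: trD.
- by move=> r a; rewrite mulrCA; exact: trM.
- by rewrite mulr1; exact: trace_path_product.
exists phi; split=> // N z [g Ig zg]; rewrite (phiE _ _ zg).
apply/(symbolic_powerE _ _ noeth hJ) => P hP.
apply: (clique_order_trace sigma_order sigma_surj hP) => //.
exact: (proj1 (symbolic_powerE _ _ noeth hJ) Ig P hP).
Qed.

(** * Vertex orders of generalized pendant cliques graphs *)

(* The place of a vertex: [Pendant i b] in the [b]-th clique joined via the [i]-th
   vertex of the path, [Spine i] for this vertex itself, and [Link i] in the clique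
   joined via the edge [{i, i + 1}] of the path. *)
Inductive place := Pendant of nat & nat | Spine of nat | Link of nat.

(** True on equal [Pendant] or [Link] places, which hold several vertices of one clique; [placed]
    excludes equal vertices separately. *)
Definition place_adj (u v : place) : bool :=
  match u, v with
  | Pendant i b, Pendant j c => (i == j) && (b == c)
  | Pendant i _, Spine j | Spine j, Pendant i _ => i == j
  | Spine i, Spine j => (i.+1 == j) || (j.+1 == i)
  | Spine i, Link j | Link j, Spine i => (i == j) || (i == j.+1)
  | Link i, Link j => i == j
  | _, _ => false
  end.

Lemma place_adjC u v : place_adj u v = place_adj v u.
Proof.
case: u v => [i b|i|i] [j c|j|j] //=; first by rewrite eq_sym (eq_sym b).
exact: orbC.
Qed.

Definition placed (V : finType) (H : sgraph V) (pl : V -> place) : Prop :=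
  (forall u v, H u v = (u != v) && place_adj (pl u) (pl v)) /\
  (forall u v i, pl u = Spine i -> pl v = Spine i -> u = v).

Definition pendant_index (u : place) : nat := if u is Pendant _ b then b else 0.

(** A join via a vertex takes a pendant index above all those in use. A join via an edge takes its
    [Link] place, still free because [U] records every one in use. *)
Lemma clique_joins_placed m (V : finType) (H : sgraph V) (f : 'I_m.+1 -> V) U :
  clique_joins H f U -> exists pl : V -> place,
  [/\ placed H pl, forall i, pl (f i) = Spine i
    & forall v (i j : 'I_m.+1), i.+1 = j -> pl v = Link i -> [set i; j] \in U].
Proof.
elim=> {V H f U} [|V H f U i t _ [pl [[adjK plI] plf plU]] _
                 |V H f U i j t _ [pl [[adjK plI] plf plU]] _ eij Uij].
- exists (fun i : 'I_m.+1 => Spine i); split=> //.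
  split=> [u v|u v i [uE] [vE]]; last by apply: val_inj; rewrite /= uE vE.
  case: eqVneq => [->|_] //; exact: adj_irr.
- pose b := (\max_v pendant_index (pl v)).+1.
  have fresh v c : pl v = Pendant c b -> False.
    move=> plv; have := leq_bigmax (F := fun v => pendant_index (pl v)) v.
    by rewrite plv /= -/b ltnn.
  have eqf u : (u == f i) = place_adj (pl u) (Pendant i b).
    apply/eqP/idP => [->|]; first by rewrite plf /=.
    case plu: (pl u) => [c d|c|c] //=.
      by move=> /andP [_ /eqP db]; case: (fresh u c); rewrite plu db.
    by move=> /eqP ic; apply: (plI _ _ c plu); rewrite plf ic.
  exists (fun v => match v with inl u => pl u | inr _ => Pendant i b end).
  split; [split | exact: plf | by case=> [u|r] l j //; exact: plU].
    move=> [u|r] [v|r'] /=; rewrite ?adjK ?inE ?eqf //.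
      by rewrite place_adjC.
    by rewrite (inj_eq inr_inj) !eqxx !andbT.
  move=> [u|r] [v|r'] c //= plu plv; congr inl; exact: plI plu plv.
wlog /eqP ltij : i j eij Uij / (i.+1 == j)%N.
  move=> wl; have [eq|eq] := orP eij; first exact: wl.
  rewrite (setUC [set f i] [set f j]) (setUC [set i] [set j]); apply: wl => //.
    by rewrite /= /path_adj orbC.
  by rewrite (setUC [set j] [set i]).
have fresh u : pl u = Link i -> False.
  by move=> /(plU _ _ _ ltij); apply/negP.
have eqf u : (u == f i) || (u == f j) = place_adj (pl u) (Link i).
  apply/orP/idP => [[/eqP ->|/eqP ->]|]; rewrite ?plf /= ?eqxx // -?ltij ?eqxx ?orbT //.
  case plu: (pl u) => [c d|c|c] //=.
    case/orP => /eqP ic; [left | right]; apply/eqP; apply: (plI _ _ c plu).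
      by rewrite plf ic.
    by rewrite plf ic ltij.
  by move=> /eqP ci; case: (fresh u); rewrite plu ci.
exists (fun v => match v with inl u => pl u | inr _ => Link i end).
split; [split | exact: plf | case=> [u|r] l l' ell' /=].
- move=> [u|r] [v|r'] /=; rewrite ?adjK ?in_set2 ?eqf //.
    by rewrite place_adjC.
  by rewrite (inj_eq inr_inj) eqxx !andbT.
- by move=> [u|r] [v|r'] c //= plu plv; congr inl; exact: plI plu plv.
- by move=> plu; rewrite in_setU (plU _ _ _ ell' plu) orbT.
case=> il; have -> : l = i by apply: val_inj; rewrite /= il.
have -> : l' = j by apply: val_inj; rewrite /= -ell' -il ltij.
by rewrite in_setU in_set1 eqxx.
Qed.

Lemma placed_iso (V W : finType) (H : sgraph V) (G : sgraph W) pl :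
  placed H pl -> graph_iso H G -> exists pl' : W -> place, placed G pl'.
Proof.
move=> [adjK plI] [h [g hK gK] Gh]; exists (pl \o g); split=> [u v|u v i /= k1 k2].
  by rewrite -[u]gK -[v]gK Gh adjK /= !hK (inj_eq (can_inj hK)).
by apply: (can_inj gK); exact: plI k1 k2.
Qed.

Definition is_spine (u : place) : bool := if u is Spine _ then true else false.

(** The neighbours of [v] are in its own place or in the spine places to which its clique is
    attached, and a spine place holds one vertex. *)
Lemma placed_simplicial n (G : sgraph 'I_n) pl v : placed G pl ->
  ~~ is_spine (pl v) -> simplicial G v.
Proof.
move=> [adjK plI] kv j l; rewrite !adjK => /andP [_ vj] /andP [_ vl] nejl.
rewrite nejl /=; have neq i : pl j = Spine i -> pl l = Spine i -> False.
  by move=> pj pl'; case/eqP: nejl; exact: plI pj pl'.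
move: vj vl kv neq {nejl}; case: (pl v) => [i b|i|i] //= vj vl _.
  case: (pl j) vj => [j1 b1|j1|j1] //=; case: (pl l) vl => [l1 c1|l1|l1] //=.
  - by move=> /andP [/eqP <- /eqP <-] /andP [/eqP <- /eqP <-] _; rewrite !eqxx.
  - by move=> /eqP <- /andP [/eqP <- _] _.
  - by move=> /andP [/eqP <- _] /eqP <-.
  - by move=> /eqP <- /eqP <- /(_ i erefl erefl).
case: (pl j) vj => [j1 b1|j1|j1] //=; case: (pl l) vl => [l1 c1|l1|l1] //=.
- move=> /orP [] /eqP -> /orP [] /eqP -> neq; rewrite ?eqxx ?orbT //.
    by case: (neq i).
  by case: (neq i.+1).
- by move=> /eqP <-.
- by move=> + /eqP <-.
- by move=> /eqP <- /eqP <-.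
Qed.

(** For each [i] in turn: the pendant cliques one by one, the spine vertex, then the clique on the
    edge to [i + 1]. *)
Definition place_rank (u : place) : nat *l nat :=
  match u with
  | Pendant i b => (3 * i, b)%N
  | Spine i => (3 * i + 1, 0)%N
  | Link i => (3 * i + 2, 0)%N
  end.

(** The first coordinates of the ranks decide all cases but that of a common pendant clique, where
    the second ones force [v] into it. The last three hypotheses reflect that distinct vertices
    never share a spine place. *)
Lemma place_rank_between (u v w : place) :
  (place_rank u <= place_rank v)%O -> (place_rank v <= place_rank w)%O ->
  place_adj u w -> (forall i, u = Spine i -> v <> Spine i) ->
  (forall i, v = Spine i -> w <> Spine i) -> (forall i, u = Spine i -> w <> Spine i) ->
  ~~ is_spine v /\ (place_adj v u \/ place_adj v w).
Proof.
have rank1 u' v' : (place_rank u' <= place_rank v')%O ->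
    ((place_rank u').1 <= (place_rank v').1)%N.
  by case: (place_rank u') (place_rank v') => [a b] [c d]; rewrite lexi_pair => /andP [].
have rank2 i b j c : (place_rank (Pendant i b) <= place_rank (Pendant j c))%O ->
    i = j -> (b <= c)%N.
  by rewrite lexi_pair => /andP [_ /implyP le] eij; apply: le; rewrite eij.
move=> le_uv le_vw; have := rank1 _ _ le_uv; have := rank1 _ _ le_vw; move: le_uv le_vw.
case: u w => [i b|i|i] [j c|j|j] //=.
- move=> le_uv le_vw le1 le2 /andP [/eqP eij /eqP ebc] _ _ _; move: le_uv le_vw le1 le2.
  case: v => [l d|l|l] /= le_uv le_vw le1 le2; [|lia|lia].
  have eil : i = l by lia.
  have elj : l = j by lia.
  have := rank2 _ _ _ _ le_uv eil; have := rank2 _ _ _ _ le_vw elj.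
  by rewrite -ebc -elj eqxx => db bd; split=> //; right; rewrite eqn_leq db.
- move=> _ _ + + /eqP eij _ vw _; case: v vw => [l d|l|l] /= vw le1 le2; last by lia.
    by split=> //; right; apply/eqP; lia.
  by case: (vw l erefl); congr Spine; lia.
- by move=> _ _; case: v => [l d|l|l] /= le1 le2 /eqP eij; lia.
- move=> _ _ + + /orP eij uv vw _.
  case: v uv vw => [l d|l|l] /= uv vw le1 le2.
  + by split=> //; right; apply/eqP; lia.
  + have [eil|elj] : i = l \/ l = j by lia.
      by case: (uv i erefl); rewrite eil.
    by case: (vw l erefl); rewrite elj.
  + by split=> //; left; apply/orP; left; apply/eqP; lia.
- move=> _ _ + + /orP eij uv _ _; case: v uv => [l d|l|l] /= uv le1 le2; first by lia.
    by case: (uv i erefl); congr Spine; lia.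
  by split=> //; left; apply/orP; left; apply/eqP; lia.
- move=> _ _ + + /orP eij _ vw _; case: v vw => [l d|l|l] /= vw le1 le2.
  + by split=> //; right; apply/eqP; lia.
  + by case: (vw l erefl); congr Spine; lia.
  + by split=> //; right; apply/orP; right; apply/eqP; lia.
- move=> _ _ + + /eqP eij _ _ _; case: v => [l d|l|l] /= le1 le2; [lia|lia|].
  by split=> //; left; apply/eqP; lia.
Qed.

(** The vertices are sorted by rank; ties are harmless, since equal ranks occur only inside one
    clique. *)
Lemma placed_clique_order n (G : sgraph 'I_n) pl : (0 < n)%N -> placed G pl ->
  exists2 sigma : nat -> 'I_n, {in gtn n &, injective sigma} & clique_order G sigma.
Proof.
case: n G pl => // n G pl _ plG; have [adjK plI] := plG.
pose le : rel 'I_n.+1 := fun u v => (place_rank (pl u) <= place_rank (pl v))%O.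
have le_total : total le by move=> u v; exact: le_total.
pose s := sort le (enum 'I_n.+1).
have size_s : size s = n.+1 by rewrite size_sort size_enum_ord.
have uniq_s : uniq s by rewrite sort_uniq enum_uniq.
have sigma_inj : {in gtn n.+1 &, injective (nth ord0 s)}.
  by move=> a b; rewrite !inE => lta ltb /eqP; rewrite nth_uniq ?size_s // => /eqP.
exists (nth ord0 s) => // a l b ltal ltlb ltbn.
have sorted_s := sort_sorted le_total (enum 'I_n.+1).
have mono i j : (i < j)%N -> (j < n.+1)%N -> le (nth ord0 s i) (nth ord0 s j).
  move=> ltij ltj; apply: (sorted_ltn_nth _ _ sorted_s) => //; rewrite ?inE ?size_s //.
    by move=> v u w; exact: le_trans.
  exact: ltn_trans ltj.
have ne i j : (i < j)%N -> (j < n.+1)%N -> nth ord0 s i != nth ord0 s j.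
  by move=> ltij ltj; rewrite nth_uniq ?size_s ?ltn_eqF // (ltn_trans ltij).
have ltln := ltn_trans ltlb ltbn; have ltab := ltn_trans ltal ltlb.
have ne_spine u v i : u != v -> pl u = Spine i -> pl v <> Spine i.
  by move=> neuv pu pv; case/eqP: neuv; exact: plI pu pv.
rewrite !adjK ![nth ord0 s l == _]eq_sym (ne a l) // (eq_sym _ (nth ord0 s l)) (ne l b) //=.
move=> /andP [_ adj_ab].
have [spl adj] := place_rank_between (mono a l ltal ltln) (mono l b ltlb ltbn) adj_ab
  (fun i => ne_spine _ _ i (ne a l ltal ltln)) (fun i => ne_spine _ _ i (ne l b ltlb ltbn))
  (fun i => ne_spine _ _ i (ne a b ltab ltbn)).
by split=> //; exact: placed_simplicial spl.
Qed.

Theorem theorem3p7 (k : fieldType) (p : nat) (hp : p \in [pchar k]%R)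
    (n : nat) (G : sgraph 'I_n) (hG : gen_pendant_cliques G) :
  symbolic_F_split p (binomial_edge_ideal k G).
Proof.
have [m [V [H [f [U [joins iso]]]]]] := hG.
have [pl [plH _ _]] := clique_joins_placed joins.
have [pl' plG] := placed_iso plH iso.
have n_gt0 : (0 < n)%N by have [h _ _] := iso; exact: leq_ltn_trans (ltn_ord (h (f ord0))).
have [sigma sigma_inj sigma_order] := placed_clique_order n_gt0 plG.
exact: clique_order_symbolic_F_split sigma_inj sigma_order.
Qed.
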